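(* For integers $n\ge0$ and $m\ge0$, the out-degree $Y_{n,0}$ of the root node $0_1$ in a random ordered increasing $k$-tree of size $n$ satisfies \[ \mathbb{P}\{Y_{n,0}=m\}=\frac{\binom{m-\frac{k-1}{k}}{m}}{\binom{n-\frac{k}{k+1}}{n}}\sum_{\ell=0}^{m}\binom{m}{\ell}(-1)^{\ell}\binom{n-1-\frac{k\ell}{k+1}}{n}. \] Moreover, as $n\to\infty$, $n^{-\frac{k}{k+1}}Y_{n,0}$ converges in distribution to a random variable $Y_0$ uniquely determined by its moments, which are, for all integers $s\ge0$, \[ \mathbb{E}(Y_0^s)=\frac{\Gamma(\frac{1}{k+1})\,\Gamma(s+\frac1k)}{\Gamma(\frac1k)\,\Gamma(\frac{k}{k+1}s+\frac{1}{k+1})}. \]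
   Context: Fix an integer $k\ge1$. An ordered increasing $k$-tree of size $n\ge0$ is built as follows. Start with the root-clique $K_0$: $k$ pairwise adjacent vertices labelled $0_1,\dots,0_k$ (the root nodes; each label $0_\ell$ has value $0$). For $j=1,\dots,n$ in turn, node $j$ is inserted by choosing a currently existing $k$-clique $K$ and attaching $j$ to it, i.e. adding edges from $j$ to all $k$ vertices of $K$; $j$ is then a child of $K$ and the vertices of $K$ are the parents of $j$. The $k$-cliques available for attachment are the root-clique and, for every previously inserted node $x$ attached to a clique $K'$, the $k$ cliques $\{x\}\cup(K'\setminus\{w\})$, $w\in K'$. The children of each $k$-clique are linearly ordered: if $K$ currently has $d^+(K)$ children, there are $d^+(K)+1$ positions at which the new child may be placed, and the choice of position is part of the structure. Thus there are $1+(k+1)(j-1)$ ways to insert node $j$, and distinct sequences of choices give distinct trees. A random ordered increasing $k$-tree of size $n$ is one chosen uniformly among all of them; equivalently, it is produced by the process in which node $n$ is attached to the clique $K$ with probability $\frac{d^+(K)+1}{1+(k+1)(n-1)}$ (and a uniformly random position among the $d^+(K)+1$). The out-degree of a node $u$ is the number of nodes having $u$ as a parent (for a root node this is its number of non-root neighbours). For real $x$ and integer $m\ge0$, $\binom{x}{m}=x(x-1)\cdots(x-m+1)/m!$, and $\binom{x}{m}=0$ for $m<0$. *)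

(* Defs.v *)
From Stdlib Require Import Reals Lra Arith List ClassicalEpsilon.
Import ListNotations.
Open Scope R_scope.

(* Vertices are nat: root node 0_l (l = 1..k) is vertex l-1; node j >= 1 is vertex k-1+j.
   So the root node 0_1 is vertex 0.
   A state is the list of currently available k-cliques, each with its current number
   of children d^+(K).  The cliques are listed in creation order. *)
Definition kstate := list (list nat * nat).

Definition init_state (k : nat) : kstate := [(seq 0 k, 0%nat)].

Definition kstep (st : kstate) (i x : nat) : kstate :=
  let '(K, d) := nth i st (nil, 0%nat) in
  map (fun c => c) (firstn i st) ++ [(K, S d)] ++ skipn (S i) st ++
  map (fun w => (x :: filter (fun v => negb (Nat.eqb v w)) K, 0%nat)) K.

(* All choice sequences ((clique index, position among its d^+(K)+1 slots) for each
   inserted node), starting from state st with next vertex label x, r insertions. *)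
Fixpoint trees_from (st : kstate) (x r : nat) : list (list (nat * nat)) :=
  match r with
  | O => [nil]
  | S r' =>
      flat_map (fun i =>
        flat_map (fun p => map (cons (i, p)) (trees_from (kstep st i x) (S x) r'))
                 (seq 0 (S (snd (nth i st (nil, 0%nat))))))
        (seq 0 (length st))
  end.

(* The list of all ordered increasing k-trees of size n (each tree = its sequence of
   choices; distinct sequences are distinct trees). *)
Definition ktrees (k n : nat) : list (list (nat * nat)) :=
  trees_from (init_state k) k n.

Fixpoint root_outdeg_from (st : kstate) (x : nat) (t : list (nat * nat)) : nat :=
  match t with
  | nil => 0%nat
  | (i, p) :: t' =>
      ((if existsb (Nat.eqb 0) (fst (nth i st (nil, 0%nat))) then 1 else 0)
       + root_outdeg_from (kstep st i x) (S x) t')%nat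
  end.

Definition root_outdeg (k : nat) (t : list (nat * nat)) : nat :=
  root_outdeg_from (init_state k) k t.

Definition prob_tree (k n : nat) (E : list (nat * nat) -> bool) : R :=
  INR (length (filter E (ktrees k n))) / INR (length (ktrees k n)).

Definition P_Y (k n m : nat) : R := prob_tree k n (fun t => Nat.eqb (root_outdeg k t) m).

Definition scaled_cdf (k n : nat) (x : R) : R :=
  prob_tree k n (fun t =>
    if Rle_dec (INR (root_outdeg k t) * Rpower (INR n) (- (INR k / INR (k + 1)))) x
    then true else false).

Fixpoint fallR (x : R) (m : nat) : R :=
  match m with O => 1 | S m' => fallR x m' * (x - INR m') end.
Definition binomR (x : R) (m : nat) : R := fallR x m / INR (fact m).

(* ---------- Gamma function (Gauss' limit formula, valid for x > 0) ---------- *)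
Fixpoint risingR (x : R) (n : nat) : R :=
  match n with O => 1 | S n' => risingR x n' * (x + INR n') end.
Definition gauss_seq (x : R) (n : nat) : R :=
  Rpower (INR n) x * INR (fact n) / risingR x (S n).
Definition Gamma (x : R) : R :=
  epsilon (inhabits 0) (fun g => Un_cv (gauss_seq x) g).

Definition is_cdf (F : R -> R) : Prop :=
  (forall x y, x <= y -> F x <= F y) /\
  (forall x eps, 0 < eps -> exists delta, 0 < delta /\
      forall y, x <= y < x + delta -> Rabs (F y - F x) < eps) /\
  (forall eps, 0 < eps -> exists M, forall x, x <= M -> Rabs (F x) < eps) /\
  (forall eps, 0 < eps -> exists M, forall x, M <= x -> Rabs (F x - 1) < eps).

Definition RS_sum (g F : R -> R) (a b : R) (N : nat) : R :=
  sum_f_R0 (fun i =>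
    g (a + INR i * (b - a) / INR (S N)) *
    (F (a + INR (S i) * (b - a) / INR (S N)) - F (a + INR i * (b - a) / INR (S N)))) N.

Definition improper_RS (g F : R -> R) (L : R) : Prop :=
  exists J : R -> R,
    (forall M, 0 < M -> Un_cv (fun N => RS_sum g F (- M) M N) (J M)) /\
    (forall eps, 0 < eps -> exists M0, forall M, M0 <= M -> Rabs (J M - L) < eps).

Definition has_moment (F : R -> R) (s : nat) (mu : R) : Prop :=
  (exists A, improper_RS (fun y => Rabs y ^ s) F A) /\
  improper_RS (fun y => y ^ s) F mu.

Definition Y0_moment (k s : nat) : R :=
  Gamma (1 / INR (k + 1)) * Gamma (INR s + 1 / INR k) /
  (Gamma (1 / INR k) * Gamma (INR k / INR (k + 1) * INR s + 1 / INR (k + 1))).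

(* Main.v *)
Require Import Defs.
From Stdlib Require Import Reals Lra Lia Arith ZArith ClassicalEpsilon.
From Coquelicot Require Import Coquelicot.
From Stdlib Require Import List.
Open Scope R_scope.

(** The slots of the cliques containing [0_1] number [1 + k Y], out of [1 + (k+1) n]
    slots in total, so [Y] is a Markov chain.  Its one-step recurrence is solved by the
    stated formula, and it is diagonal on the rising factorials of [Y + 1/k], whose
    expectations are therefore ratios of rising factorials; Gauss' formula for Gamma gives
    the limits of the moments of [X_n = n^(-k/(k+1)) Y].

    The limit moments are [o(s! / T^s)] for every [T].  Hence the Taylor polynomials of
    [H (T (x - a))], where [H x] is the integral of the Fejer kernel over [0, x], give
    polynomials [r <= 1_(x <= a + d)] and [q >= 1_(x <= a - d)] whose moment functionals
    are arbitrarily close.  This yields both the uniqueness of the limit law and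
    [F_n (a - d) <= F_m (a + d) + eps] for large [n] and [m].  The recurrence also gives
    [max_m P(Y = m) = O (n^(-k/(k+1)))], so the [F_n] are Lipschitz up to [o(1)], converge
    everywhere, and have a Lipschitz limit; no compactness theorem is needed. *)

(** * Counting trees through the root slots *)

(** A moment functional can be evaluated both on the finite averages over trees and on the improper
    Riemann-Stieltjes integrals of an arbitrary distribution function, so one pair of polynomials
    serves for convergence and for uniqueness. The Fejer kernel [(1 - cos u) / u^2] meets three
    requirements at once. It is nonnegative, so its integral is monotone and gives a step with
    values in [0, 1]. It is at most [2 / u^2], so the step has explicit tails. Its Taylor remainders
    are a power over a factorial, so after stretching by [T] the error is of order [T^s / s!] times
    a power of the variable. This stays small in mean because [E(Y_0^s)] grows, up to exponential
    factors, only like [(s!)^(1/(k+1))]. The sandwich compares distribution functions only up to a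
    horizontal shift. For uniqueness, right-continuity absorbs the shift. For convergence, the
    functions have jumps at every size, and it is the bound on the largest atom that absorbs it,
    uniformly in [n]. *)

Definition lsum {T : Type} (f : T -> R) (l : list T) : R :=
  fold_right (fun t acc => f t + acc) 0 l.

Lemma lsum_cons {T} (f : T -> R) a l : lsum f (a :: l) = f a + lsum f l.
Proof. reflexivity. Qed.

Lemma lsum_app {T} (f : T -> R) l1 l2 : lsum f (l1 ++ l2) = lsum f l1 + lsum f l2.
Proof. induction l1 as [|a l IH]; simpl; [ring | rewrite IH; ring]. Qed.

Lemma lsum_map {T U} (f : U -> R) (h : T -> U) l :
  lsum f (map h l) = lsum (fun t => f (h t)) l.
Proof. induction l as [|a l IH]; simpl; [easy | now rewrite IH]. Qed.

Lemma lsum_flat_map {T U} (f : U -> R) (h : T -> list U) l :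
  lsum f (flat_map h l) = lsum (fun t => lsum f (h t)) l.
Proof. induction l as [|a l IH]; simpl; [easy | now rewrite lsum_app, IH]. Qed.

Lemma lsum_ext_in {T} (f g : T -> R) l :
  (forall t, In t l -> f t = g t) -> lsum f l = lsum g l.
Proof.
  induction l as [|a l IH]; simpl; intros H; [easy |].
  rewrite H, IH; auto.
Qed.

Lemma lsum_lin {T} (c d : R) (f g : T -> R) l :
  lsum (fun t => c * f t + d * g t) l = c * lsum f l + d * lsum g l.
Proof. induction l as [|a l IH]; simpl; [ring | rewrite IH; ring]. Qed.

Lemma lsum_const {T} (c : R) (l : list T) : lsum (fun _ => c) l = INR (length l) * c.
Proof.
  induction l as [|a l IH]; [simpl; ring |].
  change (length (a :: l)) with (S (length l)).
  rewrite S_INR; simpl; rewrite IH; ring.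
Qed.

Lemma lsum_le {T} (f g : T -> R) l :
  (forall t, f t <= g t) -> lsum f l <= lsum g l.
Proof. intros H; induction l as [|a l IH]; simpl; [lra | specialize (H a); lra]. Qed.

Lemma lsum_nth {T} (f : T -> R) (d : T) l :
  lsum (fun i => f (nth i l d)) (seq 0 (length l)) = lsum f l.
Proof.
  induction l as [|a l IH]; simpl; [easy |].
  now rewrite <- seq_shift, lsum_map, IH.
Qed.

Lemma length_filter_lsum {T} (p : T -> bool) l :
  INR (length (filter p l)) = lsum (fun t => if p t then 1 else 0) l.
Proof.
  induction l as [|a l IH]; [easy |]; simpl; destruct (p a);
    [change (length (a :: ?l)) with (S (length l)); rewrite S_INR |]; rewrite <- IH;
    simpl length; rewrite ?S_INR; ring.
Qed.

Definition has_root (c : list nat * nat) : bool := existsb (Nat.eqb 0) (fst c).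
Definition slots (st : kstate) : R := lsum (fun c => INR (S (snd c))) st.
Definition root_slots (st : kstate) : R :=
  lsum (fun c => if has_root c then INR (S (snd c)) else 0) st.

(** Labels below the next label [x] keep the inserted vertex distinct from those of the clique, so
    cliques stay duplicate-free. The bound [1 <= x] in [good_state] keeps it apart from the root
    node, which is vertex 0. *)
Definition good_clique (k x : nat) (c : list nat * nat) : Prop :=
  NoDup (fst c) /\ length (fst c) = k /\ Forall (fun v => (v < x)%nat) (fst c).

Definition good_state (k x : nat) (st : kstate) : Prop :=
  (1 <= x)%nat /\ Forall (good_clique k x) st.

Lemma kstep_split (st : kstate) (i x : nat) (K : list nat) (d : nat) :
  nth i st (nil, 0%nat) = (K, d) -> (i < length st)%nat ->
  exists l1 l2, st = l1 ++ (K, d) :: l2 /\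
    kstep st i x = l1 ++ (K, S d) :: l2 ++
      map (fun w => (x :: filter (fun v => negb (Nat.eqb v w)) K, 0%nat)) K.
Proof.
  intros Hn Hi. exists (firstn i st), (skipn (S i) st). split.
  - rewrite <- (firstn_skipn i st) at 1. f_equal.
    rewrite <- Hn. clear Hn. revert i Hi.
    induction st as [|a st IH]; intros [|i] Hi; simpl in *; try lia; auto.
    apply IH; lia.
  - unfold kstep. rewrite Hn, map_id. reflexivity.
Qed.

Lemma length_filter_neq (K : list nat) (w : nat) :
  NoDup K -> In w K -> S (length (filter (fun v => negb (Nat.eqb v w)) K)) = length K.
Proof.
  induction K as [|a K IH]; intros Hd Hin; [easy |].
  inversion Hd as [|? ? Ha HK]; subst. simpl.
  destruct (Nat.eqb_spec a w) as [->|Hne]; simpl.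
  - f_equal. clear IH Hd Hin HK. induction K as [|b K IH]; [easy |]. simpl.
    destruct (Nat.eqb_spec b w) as [->|]; simpl.
    + exfalso; apply Ha; now left.
    + f_equal. apply IH. intros H; apply Ha; now right.
  - f_equal. apply IH; [easy |]. destruct Hin; [congruence | easy].
Qed.

Lemma good_kstep (k x i : nat) (st : kstate) :
  good_state k x st -> (i < length st)%nat -> good_state k (S x) (kstep st i x).
Proof.
  intros [Hx Hg] Hi. split; [lia |].
  destruct (nth i st (nil, 0%nat)) as [K d] eqn:Hn.
  destruct (kstep_split st i x K d Hn Hi) as (l1 & l2 & E1 & E2).
  assert (Hw : forall c, good_clique k x c -> good_clique k (S x) c).
  { intros c (H1 & H2 & H3). repeat split; auto.
    eapply Forall_impl; [| exact H3]. simpl; lia. }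
  rewrite E1 in Hg. apply Forall_app in Hg as [G1 G2].
  inversion G2 as [| ? ? GK G2']; subst.
  rewrite E2. apply Forall_app; split; [eapply Forall_impl; eauto |].
  constructor; [destruct (Hw _ GK) as (H1 & H2 & H3); repeat split; auto |].
  apply Forall_app; split; [eapply Forall_impl; eauto |].
  destruct GK as (H1 & H2 & H3); simpl in H1, H2, H3.
  apply Forall_forall. intros c Hc. apply in_map_iff in Hc as (w & <- & Hw').
  rewrite Forall_forall in H3.
  repeat split; simpl.
  - constructor; [| now apply NoDup_filter].
    intros Hin. apply filter_In in Hin as [Hin _]. specialize (H3 _ Hin). lia.
  - now rewrite length_filter_neq.
  - constructor; [lia |]. apply Forall_forall. intros v Hv.
    apply filter_In in Hv as [Hv _]. specialize (H3 _ Hv). lia.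
Qed.

Lemma existsb_eqb0 (K : list nat) : existsb (Nat.eqb 0) K = true <-> In 0%nat K.
Proof.
  rewrite existsb_exists. split.
  - intros (v & Hv & E). apply Nat.eqb_eq in E. now subst.
  - intros H. exists 0%nat. now rewrite Nat.eqb_refl.
Qed.

(** Each new clique drops one vertex of [K] and has a single slot. When 0 lies in [K], exactly one
    of the [k] new cliques drops it. *)
Lemma root_slots_new_cliques (k x d : nat) (K : list nat) :
  good_clique k x (K, d) -> (1 <= x)%nat ->
  root_slots (map (fun w => (x :: filter (fun v => negb (Nat.eqb v w)) K, 0%nat)) K) =
  if has_root (K, d) then INR k - 1 else 0.
Proof.
  intros (Hd & Hl & _) Hx. unfold root_slots. rewrite lsum_map.
  rewrite (lsum_ext_in _
    (fun w => if andb (has_root (K, d)) (negb (Nat.eqb w 0)) then 1 else 0)).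
  2:{ intros w _. simpl.
      replace (has_root (x :: filter (fun v => negb (Nat.eqb v w)) K, 0%nat))
        with (andb (has_root (K, d)) (negb (Nat.eqb w 0))); [reflexivity |].
      unfold has_root; simpl fst. apply Bool.eq_iff_eq_true.
      rewrite Bool.andb_true_iff, !existsb_eqb0, Bool.negb_true_iff, Nat.eqb_neq.
      simpl. rewrite filter_In, Bool.negb_true_iff, Nat.eqb_neq. intuition lia. }
  destruct (has_root (K, d)) eqn:E; cbn [andb].
  - rewrite <- length_filter_lsum.
    unfold has_root in E. apply existsb_eqb0 in E. simpl in Hd, Hl, E.
    rewrite <- Hl, <- (length_filter_neq K 0 Hd E), S_INR. ring.
  - rewrite lsum_const. ring.
Qed.

Lemma slots_kstep (k x i : nat) (st : kstate) :
  good_state k x st -> (i < length st)%nat ->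
  slots (kstep st i x) = slots st + INR k + 1.
Proof.
  intros [Hx Hg] Hi.
  destruct (nth i st (nil, 0%nat)) as [K d] eqn:Hn.
  destruct (kstep_split st i x K d Hn Hi) as (l1 & l2 & E1 & E2).
  assert (GK : good_clique k x (K, d)).
  { rewrite Forall_forall in Hg. apply Hg. rewrite <- Hn. now apply nth_In. }
  destruct GK as (_ & Hl & _). simpl in Hl.
  rewrite E2, E1. unfold slots.
  rewrite !lsum_app, !lsum_cons, lsum_app, lsum_map. cbn [snd].
  rewrite lsum_const, Hl, (S_INR (S d)). simpl (INR 1). ring.
Qed.

(** One slot comes from the chosen clique and [k - 1] from the new ones if it contains the root
    node. A clique avoiding the root node only creates cliques avoiding it. *)
Lemma root_slots_kstep (k x i : nat) (st : kstate) :
  good_state k x st -> (i < length st)%nat ->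
  root_slots (kstep st i x) =
  root_slots st + (if has_root (nth i st (nil, 0%nat)) then INR k else 0).
Proof.
  intros [Hx Hg] Hi.
  destruct (nth i st (nil, 0%nat)) as [K d] eqn:Hn.
  destruct (kstep_split st i x K d Hn Hi) as (l1 & l2 & E1 & E2).
  assert (GK : good_clique k x (K, d)).
  { rewrite Forall_forall in Hg. apply Hg. rewrite <- Hn. now apply nth_In. }
  pose proof (root_slots_new_cliques k x d K GK Hx) as HN.
  rewrite E2, E1. unfold root_slots in *. 
  rewrite !lsum_app, !lsum_cons, lsum_app, HN.
  change (has_root (K, S d)) with (has_root (K, d)).
  destruct (has_root (K, d)); cbn [snd]; rewrite ?(S_INR (S d)); ring.
Qed.

(* Inserting node [j+1] attaches it to the root with [1 + k y] of the [1 + (k+1) j]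
   available slots, [y] being the current out-degree of the root. *)
Definition step_op (k j : nat) (g : nat -> R) (y : nat) : R :=
  (1 + INR k * INR y) * g (S y) + ((INR k + 1) * INR j - INR k * INR y) * g y.

Fixpoint iter_op (k j r : nat) (g : nat -> R) : nat -> R :=
  match r with O => g | S r' => step_op k j (iter_op k (S j) r' g) end.

(** This lumps the tree process into a chain: the state enters only through its two slot counts,
    hence only through [y] and [j]. The out-degree already accumulated is kept as the offset [y], so
    that the induction can run over arbitrary states. *)
Lemma lsum_trees_from (k : nat) (g : nat -> R) (r : nat) :
  forall (st : kstate) (x y j : nat),
  good_state k x st ->
  root_slots st = 1 + INR k * INR y -> slots st = 1 + (INR k + 1) * INR j ->
  lsum (fun t => g (y + root_outdeg_from st x t)%nat) (trees_from st x r) =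
  iter_op k j r g y.
Proof.
  induction r as [|r IH]; intros st x y j Hg Hr Hs.
  - simpl. rewrite Nat.add_0_r. ring.
  - cbn [trees_from iter_op]. rewrite lsum_flat_map.
    set (V := iter_op k (S j) r g) in *.
    (* The contribution of one clique: each of its positions yields [V (S y)] or [V y]. Written this
       way it is linear in the two slot counts. *)
    pose (F := fun c : list nat * nat =>
      (V (S y) - V y) * (if has_root c then INR (S (snd c)) else 0) +
      V y * INR (S (snd c))).
    rewrite (lsum_ext_in _ (fun i => F (nth i st (nil, 0%nat)))).
    + rewrite lsum_nth. unfold F. rewrite lsum_lin. fold (slots st) (root_slots st). rewrite Hr, Hs.
      unfold step_op. fold V. ring.
    + intros i Hi. apply in_seq in Hi. rewrite lsum_flat_map.
      assert (Hi' : (i < length st)%nat) by lia.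
      pose proof (root_slots_kstep k x i st Hg Hi') as E1.
      pose proof (slots_kstep k x i st Hg Hi') as E2.
      pose proof (good_kstep k x i st Hg Hi') as E3.
      rewrite (lsum_ext_in _ (fun _ => if has_root (nth i st (nil, 0%nat))
                                       then V (S y) else V y)).
      * rewrite lsum_const, length_seq. unfold F. destruct (has_root _); ring.
      * intros p _. rewrite lsum_map. cbn [root_outdeg_from].
        unfold has_root in *. destruct (existsb _ _).
        -- unfold V. rewrite <- (IH (kstep st i x) (S x) (S y) (S j)); auto.
           ++ apply lsum_ext_in. intros; f_equal; lia.
           ++ rewrite E1, Hr, S_INR; ring.
           ++ rewrite E2, Hs, S_INR; ring.
        -- unfold V. rewrite <- (IH (kstep st i x) (S x) y (S j)); auto.
           ++ rewrite E1, Hr; ring.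
           ++ rewrite E2, Hs, S_INR; ring.
Qed.

Definition tsum (k n : nat) (g : nat -> R) : R :=
  lsum (fun t => g (root_outdeg k t)) (ktrees k n).

Lemma tsum_iter_op (k n : nat) (g : nat -> R) :
  (1 <= k)%nat -> tsum k n g = iter_op k 0 n g 0.
Proof.
  intros hk. unfold tsum, ktrees, root_outdeg.
  rewrite <- (lsum_trees_from k g n (init_state k) k 0 0); try easy.
  - split; [easy |]. constructor; [| constructor]. repeat split; simpl.
    + apply seq_NoDup.
    + apply length_seq.
    + apply Forall_forall. intros v Hv. apply in_seq in Hv. lia.
  - unfold root_slots, init_state, has_root; simpl.
    destruct k as [|k]; [lia |]; simpl. ring.
  - unfold slots; simpl; ring.
Qed.

(** [iter_op] peels off the first insertion, as the enumeration of trees does. A recurrence in the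
    size needs the last one peeled off instead. *)
Lemma iter_op_S (k : nat) (g : nat -> R) (r : nat) : forall j,
  iter_op k j (S r) g = iter_op k j r (step_op k (j + r) g).
Proof.
  induction r as [|r IH]; intros j.
  - simpl. now rewrite Nat.add_0_r.
  - change (iter_op k j (S (S r)) g) with (step_op k j (iter_op k (S j) (S r) g)).
    rewrite IH. simpl. now rewrite Nat.add_succ_r.
Qed.

Lemma tsum_0 (k : nat) (g : nat -> R) : (1 <= k)%nat -> tsum k 0 g = g 0%nat.
Proof. intros hk. now rewrite tsum_iter_op. Qed.

Lemma tsum_S (k n : nat) (g : nat -> R) :
  (1 <= k)%nat -> tsum k (S n) g = tsum k n (step_op k n g).
Proof. intros hk. now rewrite !tsum_iter_op, iter_op_S. Qed.

(** * The exact distribution *)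

Lemma tsum_one_S (k n : nat) :
  (1 <= k)%nat ->
  tsum k (S n) (fun _ => 1) = (1 + (INR k + 1) * INR n) * tsum k n (fun _ => 1).
Proof.
  intros hk. rewrite tsum_S by easy. unfold tsum.
  rewrite (lsum_ext_in _ (fun t => (1 + (INR k + 1) * INR n) * (fun _ => 1) t + 0 * 0)).
  - rewrite lsum_lin. ring.
  - intros t _. unfold step_op. ring.
Qed.

Lemma total_slots_pos (k n : nat) : 0 < 1 + (INR k + 1) * INR n.
Proof.
  pose proof (pos_INR k). pose proof (pos_INR n).
  assert (0 <= (INR k + 1) * INR n) by (apply Rmult_le_pos; lra). lra.
Qed.

Lemma tsum_one_pos (k n : nat) : (1 <= k)%nat -> 0 < tsum k n (fun _ => 1).
Proof.
  intros hk. induction n as [|n IH].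
  - rewrite tsum_0 by easy; lra.
  - rewrite tsum_one_S by easy. apply Rmult_lt_0_compat; [apply total_slots_pos | easy].
Qed.

Definition Ex (k n : nat) (g : nat -> R) : R := tsum k n g / tsum k n (fun _ => 1).

Lemma Ex_ext k n f g : (forall y, f y = g y) -> Ex k n f = Ex k n g.
Proof. intros H. unfold Ex, tsum. f_equal. apply lsum_ext_in. auto. Qed.

Lemma Ex_lin k n c d f g :
  Ex k n (fun y => c * f y + d * g y) = c * Ex k n f + d * Ex k n g.
Proof. unfold Ex, tsum. rewrite lsum_lin. unfold Rdiv. ring. Qed.

Lemma Ex_scal k n c f : Ex k n (fun y => c * f y) = c * Ex k n f.
Proof.
  rewrite (Ex_ext _ _ _ (fun y => c * f y + 0 * f y)) by (intros; ring).
  rewrite Ex_lin. ring.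
Qed.

Lemma Ex_plus k n f g : Ex k n (fun y => f y + g y) = Ex k n f + Ex k n g.
Proof.
  rewrite (Ex_ext _ _ _ (fun y => 1 * f y + 1 * g y)) by (intros; ring).
  rewrite Ex_lin. ring.
Qed.

Lemma Ex_minus k n f g : Ex k n (fun y => f y - g y) = Ex k n f - Ex k n g.
Proof.
  rewrite (Ex_ext _ _ _ (fun y => 1 * f y + (-1) * g y)) by (intros; ring).
  rewrite Ex_lin. ring.
Qed.

Lemma Ex_sum k n (f : nat -> nat -> R) N :
  Ex k n (fun y => sum_f_R0 (fun i => f i y) N) = sum_f_R0 (fun i => Ex k n (f i)) N.
Proof. induction N as [|N IH]; simpl; [easy |]. now rewrite Ex_plus, IH. Qed.

Section Expectation.
Variables (k : nat) (hk : (1 <= k)%nat).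

Lemma Ex_const n c : Ex k n (fun _ => c) = c.
Proof.
  rewrite (Ex_ext _ _ _ (fun y => c * 1)) by (intros; ring).
  rewrite Ex_scal. unfold Ex. pose proof (tsum_one_pos k n hk). field. lra.
Qed.

Lemma Ex_le n f g : (forall y, f y <= g y) -> Ex k n f <= Ex k n g.
Proof.
  intros H. unfold Ex. apply Rmult_le_compat_r.
  - left; apply Rinv_0_lt_compat, tsum_one_pos, hk.
  - apply lsum_le. auto.
Qed.

Lemma Ex_0 g : Ex k 0 g = g 0%nat.
Proof. unfold Ex. rewrite !tsum_0 by easy. field. Qed.

Lemma Ex_S n g : Ex k (S n) g = Ex k n (step_op k n g) / (1 + (INR k + 1) * INR n).
Proof.
  unfold Ex. rewrite tsum_one_S, tsum_S by easy.
  pose proof (total_slots_pos k n). pose proof (tsum_one_pos k n hk). field. lra.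
Qed.

Definition indic (p : nat -> bool) (y : nat) : R := if p y then 1 else 0.

Lemma indic_bounds p y : 0 <= indic p y <= 1.
Proof. unfold indic. destruct (p y); lra. Qed.

Lemma prob_tree_Ex n p :
  prob_tree k n (fun t => p (root_outdeg k t)) = Ex k n (indic p).
Proof.
  unfold prob_tree, Ex, tsum. rewrite length_filter_lsum, lsum_const, Rmult_1_r.
  reflexivity.
Qed.

Definition pmf (n m : nat) : R := Ex k n (indic (fun y => Nat.eqb y m)).

Lemma pmf_0 m : pmf 0 m = if Nat.eqb 0 m then 1 else 0.
Proof. unfold pmf. now rewrite Ex_0. Qed.

Lemma pmf_S_0 n :
  pmf (S n) 0 = (INR k + 1) * INR n / (1 + (INR k + 1) * INR n) * pmf n 0.
Proof.
  pose proof (total_slots_pos k n).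
  unfold pmf. rewrite Ex_S.
  rewrite (Ex_ext _ _ _ (fun y => (INR k + 1) * INR n * indic (fun y => Nat.eqb y 0) y)).
  - rewrite Ex_scal. field. lra.
  - intros y. unfold step_op, indic. simpl.
    destruct (Nat.eqb_spec y 0) as [->|]; simpl; ring.
Qed.

Lemma pmf_S_S n m :
  pmf (S n) (S m) =
  (1 + INR k * INR m) / (1 + (INR k + 1) * INR n) * pmf n m +
  ((INR k + 1) * INR n - INR k * INR (S m)) / (1 + (INR k + 1) * INR n) * pmf n (S m).
Proof.
  pose proof (total_slots_pos k n).
  unfold pmf. rewrite Ex_S.
  rewrite (Ex_ext _ _ _ (fun y => (1 + INR k * INR m) * indic (fun y => Nat.eqb y m) y +
    ((INR k + 1) * INR n - INR k * INR (S m)) * indic (fun y => Nat.eqb y (S m)) y)).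
  - rewrite Ex_lin. field. lra.
  - intros y. unfold step_op, indic. change (Nat.eqb (S y) (S m)) with (Nat.eqb y m).
    destruct (Nat.eqb_spec y m); destruct (Nat.eqb_spec y (S m)); subst; try ring; lia.
Qed.

Lemma pmf_gt n : forall m, (n < m)%nat -> pmf n m = 0.
Proof.
  induction n as [|n IH]; intros m Hm.
  - rewrite pmf_0. destruct m; [lia | easy].
  - destruct m as [|m]; [lia |]. rewrite pmf_S_S, !IH by lia. ring.
Qed.

End Expectation.

(** * Rising factorials and alternating binomial sums *)

Lemma risingR_head (x : R) (n : nat) : risingR x (S n) = x * risingR (x + 1) n.
Proof.
  induction n as [|n IH]; [simpl; ring |].
  change (risingR x (S n) * (x + INR (S n)) = x * (risingR (x + 1) n * (x + 1 + INR n))).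
  rewrite IH, S_INR. ring.
Qed.

Lemma fallR_risingR (n : nat) : forall x, fallR (x + INR n - 1) n = risingR x n.
Proof.
  induction n as [|n IH]; intros x; [easy |].
  rewrite risingR_head, <- IH, S_INR. simpl.
  replace (x + (INR n + 1) - 1) with (x + 1 + INR n - 1) by ring. ring.
Qed.

Lemma risingR_pos (x : R) (n : nat) : 0 < x -> 0 < risingR x n.
Proof.
  intros Hx. induction n as [|n IH]; simpl; [lra |].
  pose proof (pos_INR n). apply Rmult_lt_0_compat; lra.
Qed.

Lemma sum_f_R0_lin (c d : R) (f g : nat -> R) (n : nat) :
  sum_f_R0 (fun i => c * f i + d * g i) n = c * sum_f_R0 f n + d * sum_f_R0 g n.
Proof. induction n as [|n IH]; simpl; [easy | rewrite IH; ring]. Qed.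

(** Split [n - kap l] as [(n - kap (m+1)) + kap (m+1-l)] and absorb the last factor by
    [(m+1-l) C(m+1,l) = (m+1) C(m,l)]. The result has the shape of the recurrence [pmf_S_S]. *)
Lemma alternating_binomial_rec (n : nat) (kap : R) (f g : nat -> R) (m : nat) :
  (forall l, g l = f l * (INR n - kap * INR l)) ->
  sum_f_R0 (fun l => Binomial.C (S m) l * (-1) ^ l * g l) (S m) =
  (INR n - kap * INR (S m)) *
    sum_f_R0 (fun l => Binomial.C (S m) l * (-1) ^ l * f l) (S m) +
  kap * INR (S m) * sum_f_R0 (fun l => Binomial.C m l * (-1) ^ l * f l) m.
Proof.
  intros Hg. rewrite !tech5.
  rewrite (sum_eq (fun l => Binomial.C (S m) l * (-1) ^ l * g l)
    (fun l => (INR n - kap * INR (S m)) * (Binomial.C (S m) l * (-1) ^ l * f l) +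
      kap * INR (S m) * (Binomial.C m l * (-1) ^ l * f l))).
  - rewrite sum_f_R0_lin, Hg. ring.
  - intros l Hl. rewrite Hg.
    assert (E : (INR (S m) - INR l) * Binomial.C (S m) l = INR (S m) * Binomial.C m l).
    { unfold Binomial.C. rewrite Nat.sub_succ_l by easy.
      rewrite <- minus_INR by lia. rewrite Nat.sub_succ_l by easy.
      rewrite !fact_simpl, !mult_INR.
      pose proof (INR_fact_neq_0 l). pose proof (INR_fact_neq_0 (m - l)).
      assert (INR (S (m - l)) <> 0) by (apply not_0_INR; lia).
      field. auto. }
    transitivity ((-1) ^ l * f l * ((INR n - kap * INR (S m)) * Binomial.C (S m) l +
      kap * ((INR (S m) - INR l) * Binomial.C (S m) l))); [ring |].
    rewrite E. ring.
Qed.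

Lemma alternating_binomial_sum (m : nat) :
  sum_f_R0 (fun l => Binomial.C m l * (-1) ^ l) m = if Nat.eqb 0 m then 1 else 0.
Proof.
  transitivity ((-1 + 1) ^ m).
  - rewrite binomial. apply sum_eq. intros. rewrite pow1. ring.
  - replace (-1 + 1) with 0 by ring. destruct m; simpl; [easy | ring].
Qed.

(** In terms of rising factorials, one more insertion multiplies the summand of index [l] by
    [n - k l / (k+1)], and [alternating_binomial_rec] matches this with the chain. At size 0 the sum
    is [(1 - 1)^m]. *)
Lemma pmf_rising (k n m : nat) :
  (1 <= k)%nat ->
  pmf k n m =
  risingR (1 / INR k) m / INR (fact m) / risingR (1 / (INR k + 1)) n *
  sum_f_R0 (fun l => Binomial.C m l * (-1) ^ l *
                     risingR (- (INR k / (INR k + 1) * INR l)) n) m.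
Proof.
  intros hk. assert (Hk : 1 <= INR k) by (apply (le_INR 1); easy).
  revert m. induction n as [|n IH]; intros m.
  - rewrite pmf_0 by easy. simpl risingR.
    rewrite (sum_eq _ (fun l => Binomial.C m l * (-1) ^ l)) by (intros; ring).
    rewrite alternating_binomial_sum. destruct m; simpl; [field | ring].
  - pose proof (risingR_pos (1 / (INR k + 1)) n) as Hp.
    assert (H1 : 0 < 1 / (INR k + 1)) by (apply Rdiv_lt_0_compat; lra).
    specialize (Hp H1).
    pose proof (total_slots_pos k n). pose proof (pos_INR n).
    destruct m as [|m].
    + rewrite pmf_S_0, IH by easy. simpl. rewrite Rmult_0_r, Ropp_0.
      unfold Binomial.C; simpl. field. repeat split; lra.
    + rewrite pmf_S_S, !IH by easy.
      rewrite (alternating_binomial_rec n (INR k / (INR k + 1))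
        (fun l => risingR (- (INR k / (INR k + 1) * INR l)) n)
        (fun l => risingR (- (INR k / (INR k + 1) * INR l)) (S n))).
      2:{ intros l. cbn [risingR]. unfold Rdiv. ring. }
      rewrite fact_simpl, mult_INR.
      pose proof (INR_fact_neq_0 m).
      set (s1 := sum_f_R0 _ (S m)). set (s2 := sum_f_R0 _ m).
      simpl risingR. rewrite !S_INR. pose proof (pos_INR m).
      assert (1 + INR n * (INR k + 1) > 0) by lra.
      field. repeat split; lra.
Qed.

Lemma P_Y_formula (k n m : nat) :
  (1 <= k)%nat ->
  P_Y k n m =
  binomR (INR m - (INR k - 1) / INR k) m / binomR (INR n - INR k / INR (k + 1)) n *
  sum_f_R0 (fun l => Binomial.C m l * (-1) ^ l *
                     binomR (INR n - 1 - INR k * INR l / INR (k + 1)) n) m.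
Proof.
  intros hk. assert (Hk : 1 <= INR k) by (apply (le_INR 1); easy).
  unfold P_Y. rewrite (prob_tree_Ex k n (fun y => Nat.eqb y m)).
  fold (pmf k n m). rewrite pmf_rising by easy.
  replace (INR (k + 1)) with (INR k + 1) by (rewrite plus_INR; simpl; ring).
  unfold binomR.
  replace (INR m - (INR k - 1) / INR k) with (1 / INR k + INR m - 1) by (field; lra).
  replace (INR n - INR k / (INR k + 1)) with (1 / (INR k + 1) + INR n - 1) by (field; lra).
  rewrite !fallR_risingR.
  rewrite (sum_eq (fun l => _ * (fallR _ n / _)) (fun l => Binomial.C m l * (-1) ^ l *
    risingR (- (INR k / (INR k + 1) * INR l)) n * / INR (fact n))).
  - rewrite <- scal_sum.
    pose proof (INR_fact_neq_0 m). pose proof (INR_fact_neq_0 n).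
    assert (0 < risingR (1 / (INR k + 1)) n).
    { apply risingR_pos, Rdiv_lt_0_compat; lra. }
    field. repeat split; lra.
  - intros l _. rewrite <- (fallR_risingR n (- _)).
    replace (- (INR k / (INR k + 1) * INR l) + INR n - 1) with
     (INR n - 1 - INR k * INR l / (INR k + 1)) by (field; lra).
    unfold Rdiv. ring.
Qed.

(** * Gamma function and convergence of moments *)

Lemma exp_le (x y : R) : x <= y -> exp x <= exp y.
Proof. intros [H | ->]; [left; now apply exp_increasing | right; reflexivity]. Qed.

Lemma ln_le_pred (y : R) : 0 < y -> ln y <= y - 1.
Proof.
  intros Hy. pose proof (exp_ineq1_le (ln y)) as H. rewrite exp_ln in H by easy. lra.
Qed.

Lemma ln_succ_bounds (n : nat) :
  (1 <= n)%nat -> / (INR n + 1) <= ln (INR n + 1) - ln (INR n) <= / INR n.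
Proof.
  intros Hn. apply le_INR in Hn. simpl in Hn. split.
  - rewrite <- (Ropp_involutive (_ - _)), Ropp_minus_distr.
    rewrite <- ln_div by lra.
    pose proof (ln_le_pred (INR n / (INR n + 1))).
    assert (0 < INR n / (INR n + 1)) by (apply Rdiv_lt_0_compat; lra).
    replace (/ (INR n + 1)) with (- (INR n / (INR n + 1) - 1)) by (field; lra). lra.
  - rewrite <- ln_div by lra.
    pose proof (ln_le_pred ((INR n + 1) / INR n)).
    assert (0 < (INR n + 1) / INR n) by (apply Rdiv_lt_0_compat; lra).
    replace (/ INR n) with ((INR n + 1) / INR n - 1) by (field; lra). lra.
Qed.

Lemma gauss_seq_S (x : R) (n : nat) :
  0 < x ->
  gauss_seq x (S n) = gauss_seq x n *
    (exp (x * (ln (INR n + 1) - ln (INR n))) * ((INR n + 1) / (x + INR n + 1))).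
Proof.
  intros Hx. unfold gauss_seq, Rpower. rewrite fact_simpl, mult_INR.
  change (risingR x (S (S n))) with (risingR x (S n) * (x + INR (S n))).
  rewrite S_INR. pose proof (pos_INR n).
  pose proof (risingR_pos x (S n) Hx).
  replace (x * ln (INR n + 1)) with (x * ln (INR n) + x * (ln (INR n + 1) - ln (INR n))) by ring.
  rewrite exp_plus. field. split; lra.
Qed.

Lemma gauss_seq_pos (x : R) (n : nat) : 0 < x -> 0 < gauss_seq x n.
Proof.
  intros Hx. unfold gauss_seq. apply Rdiv_lt_0_compat; [| now apply risingR_pos].
  apply Rmult_lt_0_compat; [apply exp_pos | apply INR_fact_lt_0].
Qed.

(** From [ln (n+1) - ln n >= 1/(n+1)] the exponential factor in [gauss_seq_S] is at least
    [(x+n+1)/(n+1)], the inverse of the other factor. *)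
Lemma gauss_seq_incr (x : R) (n : nat) :
  0 < x -> (1 <= n)%nat -> gauss_seq x n <= gauss_seq x (S n).
Proof.
  intros Hx Hn. rewrite gauss_seq_S by easy.
  pose proof (gauss_seq_pos x n Hx). destruct (ln_succ_bounds n Hn) as [Hb _].
  apply le_INR in Hn; simpl in Hn.
  rewrite <- (Rmult_1_r (gauss_seq x n)) at 1. apply Rmult_le_compat_l; [lra |].
  set (d := ln _ - ln _) in *.
  assert (H1 : 1 + x * / (INR n + 1) <= exp (x * d)).
  { eapply Rle_trans; [| apply exp_ineq1_le].
    apply Rplus_le_compat_l, Rmult_le_compat_l; lra. }
  apply Rle_trans with ((1 + x * / (INR n + 1)) * ((INR n + 1) / (x + INR n + 1))).
  - right. field. split; lra.
  - apply Rmult_le_compat_r; [| easy]. left. apply Rdiv_lt_0_compat; lra.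
Qed.

(** The correction factor turns the increasing sequence into a nonincreasing one and so bounds it.
    The logarithm of the ratio of consecutive terms is at most
    [x/n - x/(x+n+1) = x(1+x)/(n(x+n+1))], which is below [x(1+x)(1/n - 1/(n+1))]. *)
Lemma gauss_seq_upper (x : R) (n : nat) :
  0 < x -> (1 <= n)%nat ->
  gauss_seq x (S n) * exp (x * (1 + x) * / INR (S n)) <=
  gauss_seq x n * exp (x * (1 + x) * / INR n).
Proof.
  intros Hx Hn. rewrite gauss_seq_S by easy.
  pose proof (gauss_seq_pos x n Hx). destruct (ln_succ_bounds n Hn) as [_ Hb].
  apply le_INR in Hn; simpl in Hn.
  rewrite Rmult_assoc. apply Rmult_le_compat_l; [lra |].
  set (d := ln _ - ln _) in *. rewrite S_INR.
  assert (H1 : (INR n + 1) / (x + INR n + 1) <= exp (- (x / (x + INR n + 1)))).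
  { eapply Rle_trans; [| apply exp_ineq1_le]. right. field. lra. }
  apply Rle_trans with (exp (x * d) * exp (- (x / (x + INR n + 1))) *
    exp (x * (1 + x) * / (INR n + 1))).
  - apply Rmult_le_compat_r; [left; apply exp_pos |].
    apply Rmult_le_compat_l; [left; apply exp_pos | easy].
  - rewrite <- !exp_plus. apply exp_le.
    apply Rle_trans with (x * / INR n + - (x / (x + INR n + 1)) + x * (1 + x) * / (INR n + 1)).
    { apply Rplus_le_compat_r, Rplus_le_compat_r, Rmult_le_compat_l; lra. }
    apply Rminus_le.
    replace (_ - _) with (- (x * (1 + x) * x / (INR n * (INR n + 1) * (x + INR n + 1))))
      by (field; repeat split; lra).
    assert (0 <= x * (1 + x) * x / (INR n * (INR n + 1) * (x + INR n + 1))); [| lra].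
    assert (0 < x * (1 + x)) by (apply Rmult_lt_0_compat; lra).
    assert (0 < x * (1 + x) * x) by (apply Rmult_lt_0_compat; lra).
    apply Rdiv_le_0_compat; [lra |].
    apply Rmult_lt_0_compat; [apply Rmult_lt_0_compat |]; lra.
Qed.

Lemma gauss_seq_cv (x : R) :
  0 < x -> exists g, 0 < g /\ is_lim_seq (gauss_seq x) g.
Proof.
  intros Hx.
  (* The index is shifted because consecutive terms are compared only from [n = 1] on; the term at 0
     rests on the default value of [ln 0]. *)
  destruct (ex_finite_lim_seq_incr (fun n => gauss_seq x (S n))
    (gauss_seq x 1 * exp (x * (1 + x) * / INR 1))) as [g Hg].
  - intros n. apply gauss_seq_incr; [easy | lia].
  - intros n. apply Rle_trans with (gauss_seq x (S n) * exp (x * (1 + x) * / INR (S n))).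
    + rewrite <- (Rmult_1_r (gauss_seq x (S n))) at 1.
      apply Rmult_le_compat_l; [left; now apply gauss_seq_pos |].
      eapply Rle_trans; [| apply exp_ineq1_le].
      apply Rle_trans with (1 + 0); [lra | apply Rplus_le_compat_l].
      apply Rmult_le_pos; [nra |].
      left. apply Rinv_0_lt_compat, lt_0_INR. lia.
    + induction n as [|n IH]; [lra |].
      eapply Rle_trans; [apply gauss_seq_upper; [easy | lia] | exact IH].
  - exists g. split.
    + apply Rlt_le_trans with (gauss_seq x 1); [now apply gauss_seq_pos |].
      assert (H : Rbar_le (gauss_seq x 1) g); [| exact H].
      eapply is_lim_seq_le; [| apply is_lim_seq_const | exact Hg].
      intros n. induction n as [|n IH]; [lra |].
      eapply Rle_trans; [exact IH |]. apply gauss_seq_incr; [easy | lia].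
    + now apply is_lim_seq_incr_1.
Qed.

Lemma Gamma_lim (x : R) : 0 < x -> is_lim_seq (gauss_seq x) (Gamma x).
Proof.
  intros Hx. apply is_lim_seq_Reals. unfold Gamma. apply epsilon_spec.
  destruct (gauss_seq_cv x Hx) as (g & _ & Hg). exists g. now apply is_lim_seq_Reals.
Qed.

Lemma Gamma_pos (x : R) : 0 < x -> 0 < Gamma x.
Proof.
  intros Hx. destruct (gauss_seq_cv x Hx) as (g & Hg & Hl).
  pose proof (is_lim_seq_unique _ _ (Gamma_lim x Hx)) as E1.
  rewrite (is_lim_seq_unique _ _ Hl) in E1. injection E1. intros ->. exact Hg.
Qed.

Lemma is_lim_seq_inv_INR (b : R) : is_lim_seq (fun n => / (b + INR n)) 0.
Proof.
  apply (is_lim_seq_inv _ p_infty); [| easy].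
  eapply is_lim_seq_plus; [apply is_lim_seq_const | apply is_lim_seq_INR | easy].
Qed.

(** In the quotient of two Gauss sequences the factorials cancel, and the last factors of the rising
    factorials leave [(b+n)/(a+n)]. The factor [1 + (a-b)/(b+n)] removes it. *)
Lemma risingR_ratio_lim (a b : R) :
  0 < a -> 0 < b ->
  is_lim_seq (fun n => risingR b n / risingR a n * Rpower (INR n) (a - b))
             (Gamma a / Gamma b).
Proof.
  intros Ha Hb.
  apply is_lim_seq_ext with
    (fun n => gauss_seq a n / gauss_seq b n * (1 + (a - b) * / (b + INR n))).
  - intros n. unfold gauss_seq.
    change (risingR a (S n)) with (risingR a n * (a + INR n)).
    change (risingR b (S n)) with (risingR b n * (b + INR n)).
    unfold Rpower.
    replace ((a - b) * ln (INR n)) with (a * ln (INR n) + - (b * ln (INR n))) by ring.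
    rewrite exp_plus, exp_Ropp.
    pose proof (exp_pos (b * ln (INR n))). pose proof (INR_fact_lt_0 n).
    pose proof (risingR_pos a n Ha). pose proof (risingR_pos b n Hb). pose proof (pos_INR n).
    field. repeat split; lra.
  - replace (Finite (Gamma a / Gamma b)) with (Finite (Gamma a / Gamma b * (1 + (a - b) * 0)))
      by (f_equal; ring).
    pose proof (Gamma_pos b Hb).
    apply is_lim_seq_mult'.
    + apply is_lim_seq_div'; [now apply Gamma_lim .. | lra].
    + apply is_lim_seq_plus'; [apply is_lim_seq_const |].
      apply is_lim_seq_mult'; [apply is_lim_seq_const | apply is_lim_seq_inv_INR].
Qed.

(** The limit of [risingR_ratio_lim] for the parameters [x] and [x + 1] is computed a second time,
    from the explicit ratio [(x+n)/x]. *)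
Lemma Gamma_succ (x : R) : 0 < x -> Gamma (x + 1) = x * Gamma x.
Proof.
  intros Hx.
  assert (Hx1 : 0 < x + 1) by lra.
  pose proof (risingR_ratio_lim x (x + 1) Hx Hx1) as H1.
  assert (H2 : is_lim_seq (fun n => risingR (x + 1) n / risingR x n *
                            Rpower (INR n) (x - (x + 1))) (/ x)).
  { apply is_lim_seq_ext_loc with (fun n => / x + / (0 + INR n)).
    - exists 1%nat. intros n Hn. apply le_INR in Hn; simpl in Hn.
      replace (x - (x + 1)) with (- (1)) by ring.
      rewrite Rpower_Ropp, Rpower_1 by lra.
      assert (E : x * risingR (x + 1) n = risingR x n * (x + INR n))
        by (rewrite <- risingR_head; reflexivity).
      pose proof (risingR_pos x n Hx).
      replace (risingR (x + 1) n) with (risingR x n * (x + INR n) / x)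
        by (rewrite <- E; field; lra).
      rewrite Rplus_0_l. field. repeat split; lra.
    - replace (Finite (/ x)) with (Finite (/ x + 0)) by (f_equal; ring).
      apply is_lim_seq_plus'; [apply is_lim_seq_const | apply is_lim_seq_inv_INR]. }
  apply is_lim_seq_unique in H1. apply is_lim_seq_unique in H2.
  rewrite H1 in H2. injection H2. intros E.
  pose proof (Gamma_pos x Hx). pose proof (Gamma_pos _ Hx1).
  apply (f_equal (fun z => z * x * Gamma (x + 1))) in E.
  field_simplify in E; lra.
Qed.

Lemma Gamma_plus_nat (x : R) (m : nat) : 0 < x -> Gamma (x + INR m) = risingR x m * Gamma x.
Proof.
  intros Hx. induction m as [|m IH].
  - simpl. rewrite Rplus_0_r. ring.
  - pose proof (pos_INR m). rewrite S_INR, <- Rplus_assoc, Gamma_succ, IH by lra.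
    simpl. ring.
Qed.

Section Moments.
Variables (k : nat) (hk : (1 <= k)%nat).

Lemma INR_k_ge_1 : 1 <= INR k.
Proof. apply (le_INR 1); easy. Qed.

Definition kap : R := INR k / INR (k + 1).

Lemma INR_k_plus_1 : INR (k + 1) = INR k + 1.
Proof. rewrite plus_INR; simpl; ring. Qed.

Lemma kap_pos : 0 < kap.
Proof.
  pose proof INR_k_ge_1. unfold kap. rewrite INR_k_plus_1.
  apply Rdiv_lt_0_compat; lra.
Qed.

Definition scale (n : nat) : R := Rpower (INR n) (- kap).

Lemma scale_pos (n : nat) : 0 < scale n.
Proof. apply exp_pos. Qed.

Lemma scale_pow (n s : nat) : scale n ^ s = Rpower (INR n) (- (kap * INR s)).
Proof.
  rewrite <- Rpower_pow by apply scale_pos. unfold scale.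
  rewrite Rpower_mult. f_equal. ring.
Qed.

Lemma scale_lim : is_lim_seq scale 0.
Proof.
  unfold scale, Rpower. pose proof kap_pos.
  apply (is_lim_comp_seq exp _ m_infty 0 is_lim_exp_m); [now exists 0%nat |].
  apply is_lim_seq_ext with (fun n => - (kap * ln (INR n))); [intros; ring |].
  apply (is_lim_seq_opp _ p_infty).
  replace p_infty with (Rbar_mult kap p_infty).
  - apply is_lim_seq_scal_l.
    apply (is_lim_comp_seq ln _ p_infty p_infty is_lim_ln_p); [now exists 0%nat |].
    apply is_lim_seq_INR.
  - simpl. destruct (Rle_dec 0 kap) as [h|h]; [| lra].
    destruct (Rle_lt_or_eq_dec 0 kap h); [easy | lra].
Qed.

(** With [z = y + 1/k] the insertion weight is [k z], and [z (z+1)...(z+s)] is the rising factorial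
    of [z] times [z + s]. Hence the rising factorial is an eigenfunction of [step_op k n], with
    eigenvalue [1 + (k+1) n + k s]. *)
Lemma Ex_risingR (n s : nat) :
  Ex k n (fun y => risingR (INR y + 1 / INR k) s) =
  risingR (1 / INR k) s *
  (risingR (kap * INR s + 1 / INR (k + 1)) n / risingR (1 / INR (k + 1)) n).
Proof.
  pose proof INR_k_ge_1 as Hk.
  unfold kap. rewrite INR_k_plus_1.
  induction n as [|n IH].
  - rewrite Ex_0 by easy. simpl. rewrite Rplus_0_l. field.
  - pose proof (total_slots_pos k n). pose proof (pos_INR n).
    rewrite Ex_S by easy.
    rewrite (Ex_ext _ _ _ (fun y => (1 + (INR k + 1) * INR n + INR k * INR s) *
       risingR (INR y + 1 / INR k) s)).
    + rewrite Ex_scal, IH. cbn [risingR].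
      assert (0 < risingR (1 / (INR k + 1)) n).
      { apply risingR_pos, Rdiv_lt_0_compat; lra. }
      field. repeat split; lra.
    + intros y. unfold step_op. rewrite S_INR.
      replace (INR y + 1 + 1 / INR k) with (INR y + 1 / INR k + 1) by ring.
      set (z := INR y + 1 / INR k).
      replace (1 + INR k * INR y) with (INR k * z) by (unfold z; field; lra).
      rewrite Rmult_assoc, <- risingR_head. cbn [risingR].
      replace ((INR k + 1) * INR n - INR k * INR y) with
        ((INR k + 1) * INR n + 1 - INR k * z) by (unfold z; field; lra).
      ring.
Qed.

Lemma Y0_moment_risingR (s : nat) :
  Y0_moment k s = risingR (1 / INR k) s *
    (Gamma (1 / INR (k + 1)) / Gamma (kap * INR s + 1 / INR (k + 1))).
Proof.
  pose proof INR_k_ge_1 as Hk. pose proof kap_pos as Hkap.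
  unfold Y0_moment. rewrite (Rplus_comm (INR s)), Gamma_plus_nat.
  2:{ apply Rdiv_lt_0_compat; lra. }
  assert (0 < Gamma (1 / INR k)) by (apply Gamma_pos, Rdiv_lt_0_compat; lra).
  fold kap.
  assert (0 < Gamma (kap * INR s + 1 / INR (k + 1))).
  { apply Gamma_pos. rewrite INR_k_plus_1.
    assert (0 < 1 / (INR k + 1)) by (apply Rdiv_lt_0_compat; lra).
    pose proof (pos_INR s). nra. }
  field. split; lra.
Qed.

(** Powers are traded for rising factorials one factor at a time: [y] times the rising factorial of
    order [s] is the one of order [s+1] minus [1/k + s] times the one of order [s]. The subtracted
    term keeps a spare factor [scale n] and vanishes. *)
Lemma Ex_mixed_moment_lim (j : nat) : forall s,
  is_lim_seq
    (fun n => Ex k n (fun y => INR y ^ j * risingR (INR y + 1 / INR k) s) * scale n ^ (j + s))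
    (Y0_moment k (j + s)).
Proof.
  pose proof INR_k_ge_1 as Hk. pose proof kap_pos as Hkap.
  induction j as [|j IH]; intros s.
  - rewrite Y0_moment_risingR.
    assert (Ha : 0 < 1 / INR (k + 1)).
    { rewrite INR_k_plus_1. apply Rdiv_lt_0_compat; lra. }
    assert (Hb : 0 < kap * INR s + 1 / INR (k + 1)).
    { pose proof (pos_INR s). nra. }
    apply is_lim_seq_ext with (fun n => risingR (1 / INR k) s *
      (risingR (kap * INR s + 1 / INR (k + 1)) n / risingR (1 / INR (k + 1)) n *
      Rpower (INR n) (1 / INR (k + 1) - (kap * INR s + 1 / INR (k + 1))))).
    + intros n. simpl (0 + s)%nat. rewrite scale_pow.
      rewrite (Ex_ext _ _ _ (fun y => risingR (INR y + 1 / INR k) s))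
        by (intros; simpl; ring).
      rewrite Ex_risingR.
      replace (1 / INR (k + 1) - (kap * INR s + 1 / INR (k + 1))) with (- (kap * INR s)) by ring.
      ring.
    + apply (is_lim_seq_scal_l _ (risingR (1 / INR k) s) (Finite _)).
      now apply risingR_ratio_lim.
  - pose proof (IH (S s)) as H1. pose proof (IH s) as H2.
    replace (j + S s)%nat with (S j + s)%nat in H1 by lia.
    apply is_lim_seq_ext with (fun n =>
      Ex k n (fun y => INR y ^ j * risingR (INR y + 1 / INR k) (S s)) * scale n ^ (S j + s) -
      (1 / INR k + INR s) * (scale n *
      (Ex k n (fun y => INR y ^ j * risingR (INR y + 1 / INR k) s) * scale n ^ (j + s)))).
    + intros n.
      rewrite (Ex_ext _ _ (fun y => INR y ^ S j * _) (fun y =>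
        1 * (INR y ^ j * risingR (INR y + 1 / INR k) (S s)) +
        - (1 / INR k + INR s) * (INR y ^ j * risingR (INR y + 1 / INR k) s)))
        by (intros; simpl; ring).
      rewrite Ex_lin. simpl. ring.
    + replace (Finite (Y0_moment k (S j + s))) with
        (Finite (Y0_moment k (S j + s) - (1 / INR k + INR s) * (0 * Y0_moment k (j + s))))
        by (f_equal; ring).
      apply is_lim_seq_minus'; [exact H1 |].
      apply is_lim_seq_mult'; [apply is_lim_seq_const |].
      apply is_lim_seq_mult'; [apply scale_lim | exact H2].
Qed.

Lemma Ex_moment_lim (s : nat) :
  is_lim_seq (fun n => Ex k n (fun y => (INR y * scale n) ^ s)) (Y0_moment k s).
Proof.
  pose proof (Ex_mixed_moment_lim s 0) as H. rewrite Nat.add_0_r in H.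
  eapply is_lim_seq_ext; [| exact H]. intros n. cbv beta.
  rewrite Rmult_comm, <- Ex_scal. apply Ex_ext. intros y.
  rewrite Rpow_mult_distr. simpl. ring.
Qed.

Lemma Y0_moment_nonneg (s : nat) : 0 <= Y0_moment k s.
Proof.
  assert (H : Rbar_le 0 (Y0_moment k s)); [| exact H].
  eapply is_lim_seq_le; [| apply is_lim_seq_const | apply Ex_moment_lim].
  intros n. cbv beta. rewrite <- (Ex_const k hk n 0). apply Ex_le; [easy |]. intros y.
  apply pow_le, Rmult_le_pos; [apply pos_INR | left; apply scale_pos].
Qed.

End Moments.

(** * A smoothed step of exponential type *)

Lemma nonneg_derivative_le (f df : R -> R) (a b : R) :
  a <= b -> (forall x, a <= x <= b -> is_derive f x (df x) /\ 0 <= df x) -> f a <= f b.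
Proof.
  intros Hab H.
  destruct (MVT_gen f a b df) as (c & Hc & E).
  - intros x Hx. rewrite Rmin_left, Rmax_right in Hx by easy. apply H; lra.
  - intros x Hx. rewrite Rmin_left, Rmax_right in Hx by easy.
    apply derivable_continuous_pt. exists (df x). apply is_derive_Reals, H; lra.
  - rewrite Rmin_left, Rmax_right in Hc by easy.
    destruct (H c Hc) as [_ H0]. assert (0 <= df c * (b - a)) by (apply Rmult_le_pos; lra). lra.
Qed.

Definition cos_poly (m : nat) (u : R) : R :=
  sum_f_R0 (fun i => (-1) ^ i * u ^ (2 * i) / INR (fact (2 * i))) m.
Definition sin_poly (m : nat) (u : R) : R :=
  sum_f_R0 (fun i => (-1) ^ i * u ^ (2 * i + 1) / INR (fact (2 * i + 1))) m.
(** Taylor polynomials at 0 of [(1 - cos u) / u^2] and, next, of its integral from 0. *)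
Definition fejer_poly (m : nat) (u : R) : R :=
  sum_f_R0 (fun i => (-1) ^ i * u ^ (2 * i) / INR (fact (2 * i + 2))) m.
Definition fejer_int_poly (m : nat) (u : R) : R :=
  sum_f_R0 (fun i => (-1) ^ i * u ^ (2 * i + 1) / (INR (2 * i + 1) * INR (fact (2 * i + 2)))) m.

Lemma is_derive_sum_f_R0 (f df : nat -> R -> R) (x : R) (n : nat) :
  (forall i, is_derive (f i) x (df i x)) ->
  is_derive (fun x => sum_f_R0 (fun i => f i x) n) x (sum_f_R0 (fun i => df i x) n).
Proof.
  intros H. induction n as [|n IH]; simpl; [apply H |].
  apply (is_derive_plus (fun x => sum_f_R0 (fun i => f i x) n) (f (S n))); [exact IH | apply H].
Qed.

Lemma is_derive_odd_monomial (c : R) (i : nat) (x : R) :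
  is_derive (fun x => c * x ^ (2 * i + 1)) x (c * INR (2 * i + 1) * x ^ (2 * i)).
Proof.
  auto_derive; [easy |]. change (i + (i + 0))%nat with (2 * i)%nat.
  replace (pred (2 * i + 1)) with (2 * i)%nat by lia. ring.
Qed.

Lemma is_derive_even_monomial (c : R) (i : nat) (x : R) :
  is_derive (fun x => c * x ^ (2 * i + 2)) x (c * INR (2 * i + 2) * x ^ (2 * i + 1)).
Proof.
  auto_derive; [easy |]. change (i + (i + 0))%nat with (2 * i)%nat.
  replace (pred (2 * i + 2)) with (2 * i + 1)%nat by lia. ring.
Qed.

Lemma is_derive_sin_poly (m : nat) (x : R) : is_derive (sin_poly m) x (cos_poly m x).
Proof.
  apply (is_derive_sum_f_R0 (fun i u => (-1) ^ i * u ^ (2 * i + 1) / INR (fact (2 * i + 1)))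
    (fun i u => (-1) ^ i * u ^ (2 * i) / INR (fact (2 * i)))).
  intros i. apply is_derive_ext with
    (fun x => (-1) ^ i / INR (fact (2 * i + 1)) * x ^ (2 * i + 1)).
  { intros u. apply (f_equal (fun z : R => z)). unfold Rdiv. ring. }
  evar_last; [apply is_derive_odd_monomial |].
  replace (2 * i + 1)%nat with (S (2 * i)) by lia. rewrite fact_simpl, mult_INR.
  pose proof (INR_fact_neq_0 (2 * i)).
  assert (INR (S (2 * i)) <> 0) by (apply not_0_INR; lia). field. auto.
Qed.

Lemma is_derive_fejer_int_poly (m : nat) (x : R) :
  is_derive (fejer_int_poly m) x (fejer_poly m x).
Proof.
  apply (is_derive_sum_f_R0
    (fun i u => (-1) ^ i * u ^ (2 * i + 1) / (INR (2 * i + 1) * INR (fact (2 * i + 2))))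
    (fun i u => (-1) ^ i * u ^ (2 * i) / INR (fact (2 * i + 2)))).
  intros i. apply is_derive_ext with
    (fun x => (-1) ^ i / (INR (2 * i + 1) * INR (fact (2 * i + 2))) * x ^ (2 * i + 1)).
  { intros u. apply (f_equal (fun z : R => z)). unfold Rdiv. ring. }
  evar_last; [apply is_derive_odd_monomial |].
  pose proof (INR_fact_neq_0 (2 * i + 2)).
  assert (INR (2 * i + 1) <> 0) by (apply not_0_INR; lia). field. auto.
Qed.

Lemma cos_poly_S (m : nat) (u : R) : cos_poly (S m) u = 1 - u ^ 2 * fejer_poly m u.
Proof.
  unfold cos_poly, fejer_poly. induction m as [|m IH].
  - simpl. field.
  - rewrite tech5, IH, tech5.
    replace (2 * S (S m))%nat with (2 * S m + 2)%nat by lia.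
    rewrite pow_add. change ((-1) ^ S (S m)) with (-1 * (-1) ^ S m). unfold Rdiv. ring.
Qed.

Lemma is_derive_cos_poly_S (m : nat) (x : R) :
  is_derive (cos_poly (S m)) x (- sin_poly m x).
Proof.
  induction m as [|m IH].
  - unfold cos_poly, sin_poly. simpl. auto_derive; [easy |]. field.
  - apply (is_derive_ext (fun x => cos_poly (S m) x +
      (-1) ^ S (S m) * x ^ (2 * S (S m)) / INR (fact (2 * S (S m))))); [easy |].
    unfold sin_poly in *. rewrite tech5, Ropp_plus_distr.
    apply (is_derive_plus (cos_poly (S m))); [exact IH |].
    apply is_derive_ext with
      (fun x => (-1) ^ S (S m) / INR (fact (2 * S m + 2)) * x ^ (2 * S m + 2)).
    { intros u. apply (f_equal (fun z : R => z)).
      replace (2 * S (S m))%nat with (2 * S m + 2)%nat by lia. unfold Rdiv. ring. }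
    evar_last; [apply is_derive_even_monomial |].
    replace (2 * S m + 2)%nat with (S (2 * S m + 1)) by lia. rewrite fact_simpl, mult_INR.
    change ((-1) ^ S (S m)) with (-1 * (-1) ^ S m).
    pose proof (INR_fact_neq_0 (2 * S m + 1)).
    assert (INR (S (2 * S m + 1)) <> 0) by (apply not_0_INR; lia).
    unfold Rdiv. field. auto.
Qed.

(** Repeated integration from 0, starting at [cos u <= 1]: the sign of the error of [cos_poly m]
    passes to [sin_poly m], and from there, reversed, to [cos_poly (S m)]. *)
Lemma cos_sin_poly_alternate (m : nat) :
  forall u, 0 <= u -> 0 <= (-1) ^ S m * (cos u - cos_poly m u) /\
                      0 <= (-1) ^ S m * (sin u - sin_poly m u).
Proof.
  assert (Hsin : forall m, (forall u, 0 <= u -> 0 <= (-1) ^ S m * (cos u - cos_poly m u)) ->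
    forall u, 0 <= u -> 0 <= (-1) ^ S m * (sin u - sin_poly m u)).
  { clear m. intros m H u Hu.
    replace 0 with ((-1) ^ S m * (sin 0 - sin_poly m 0)).
    2:{ rewrite sin_0. replace (sin_poly m 0) with 0; [ring |].
        symmetry; apply sum_eq_R0. intros i _. rewrite pow_i by lia. unfold Rdiv; ring. }
    apply (nonneg_derivative_le (fun u => (-1) ^ S m * (sin u - sin_poly m u))
      (fun u => (-1) ^ S m * (cos u - cos_poly m u))); [easy |].
    intros x Hx. split; [| apply H; lra].
    apply (is_derive_scal (fun u => sin u - sin_poly m u)).
    apply (is_derive_minus sin (sin_poly m)); [apply is_derive_sin | apply is_derive_sin_poly]. }
  assert (Hcos : forall u, 0 <= u -> 0 <= (-1) ^ S m * (cos u - cos_poly m u)).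
  { induction m as [|m IH]; intros u Hu.
    - unfold cos_poly; simpl. pose proof (COS_bound u). lra.
    - replace 0 with ((-1) ^ S (S m) * (cos 0 - cos_poly (S m) 0)).
      2:{ rewrite cos_0, cos_poly_S. ring. }
      apply (nonneg_derivative_le (fun u => (-1) ^ S (S m) * (cos u - cos_poly (S m) u))
        (fun u => (-1) ^ S m * (sin u - sin_poly m u))); [easy |].
      intros x Hx. split; [| apply Hsin; [exact IH | lra]].
      replace ((-1) ^ S m * (sin x - sin_poly m x)) with
        ((-1) ^ S (S m) * (- sin x - - sin_poly m x)) by (simpl; ring).
      apply (is_derive_scal (fun u => cos u - cos_poly (S m) u)).
      apply (is_derive_minus cos (cos_poly (S m)));
        [apply is_derive_cos | apply is_derive_cos_poly_S]. }
  intros u Hu. split; [now apply Hcos | now apply Hsin].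
Qed.

Lemma pow_even_opp (u : R) (i : nat) : (- u) ^ (2 * i) = u ^ (2 * i).
Proof. rewrite !pow_mult. f_equal. ring. Qed.

(** The errors of [cos_poly m] and [cos_poly (S m)] have opposite signs, so the first is at most the
    term by which these polynomials differ. Evenness covers negative [u]. *)
Lemma cos_poly_remainder (m : nat) (u : R) :
  Rabs (cos u - cos_poly m u) <= u ^ (2 * m + 2) / INR (fact (2 * m + 2)).
Proof.
  assert (Hpos : forall u, 0 <= u ->
    Rabs (cos u - cos_poly m u) <= u ^ (2 * m + 2) / INR (fact (2 * m + 2))).
  { clear u. intros u Hu.
    destruct (cos_sin_poly_alternate m u Hu) as [H1 _].
    destruct (cos_sin_poly_alternate (S m) u Hu) as [H2 _].
    unfold cos_poly in *. rewrite tech5 in H2.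
    replace (2 * S m)%nat with (2 * m + 2)%nat in H2 by lia.
    set (t := u ^ (2 * m + 2) / INR (fact (2 * m + 2))).
    set (p := sum_f_R0 _ m) in *.
    assert (E : Rabs (cos u - p) = (-1) ^ S m * (cos u - p)).
    { rewrite <- (Rabs_right ((-1) ^ S m * (cos u - p))) by lra.
      rewrite Rabs_mult, pow_1_abs. ring. }
    rewrite E.
    replace ((-1) ^ S (S m) * _) with (t * ((-1) ^ S m * (-1) ^ S m) - (-1) ^ S m * (cos u - p))
      in H2 by (unfold t; simpl; unfold Rdiv; ring).
    rewrite <- Rpow_mult_distr in H2.
    replace (-1 * -1) with 1 in H2 by ring. rewrite pow1 in H2. lra. }
  destruct (Rle_dec 0 u) as [Hu | Hu]; [now apply Hpos |].
  specialize (Hpos (- u)). rewrite cos_neg in Hpos.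
  replace (2 * m + 2)%nat with (2 * (m + 1))%nat in * by lia.
  rewrite pow_even_opp in Hpos.
  replace (cos_poly m (- u)) with (cos_poly m u) in Hpos; [apply Hpos; lra |].
  apply sum_eq. intros i _. now rewrite pow_even_opp.
Qed.

(* The Fejer kernel [(1 - cos u) / u^2], up to normalisation. *)
Definition fejer (u : R) : R := if Req_EM_T u 0 then 1 / 2 else (1 - cos u) / u ^ 2.

Lemma fejer_remainder (m : nat) (u : R) :
  Rabs (fejer u - fejer_poly m u) <= u ^ (2 * m + 2) / INR (fact (2 * m + 4)).
Proof.
  unfold fejer. destruct (Req_EM_T u 0) as [-> | Hu].
  - replace (fejer_poly m 0) with (1 / 2).
    + rewrite pow_i by lia. rewrite Rminus_diag, Rabs_R0. unfold Rdiv; lra.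
    + unfold fejer_poly. destruct m; [simpl; field |].
      rewrite decomp_sum by lia. rewrite sum_eq_R0; [simpl; field |].
      intros i _. rewrite pow_i by lia. unfold Rdiv; ring.
  - pose proof (cos_poly_remainder (S m) u) as H. rewrite cos_poly_S in H.
    replace (2 * S m + 2)%nat with (2 * m + 2 + 2)%nat in H by lia.
    rewrite pow_add in H. replace (2 * m + 2 + 2)%nat with (2 * m + 4)%nat in H by lia.
    assert (Hu2 : 0 < u ^ 2) by (apply pow2_gt_0; easy).
    replace ((1 - cos u) / u ^ 2 - fejer_poly m u) with
      (- ((cos u - (1 - u ^ 2 * fejer_poly m u)) / u ^ 2)) by (field; easy).
    rewrite Rabs_Ropp. unfold Rdiv at 1. rewrite Rabs_mult, Rabs_inv, (Rabs_right (u ^ 2)) by lra.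
    apply (Rmult_le_reg_r (u ^ 2)); [easy |].
    rewrite Rmult_assoc, Rinv_l, Rmult_1_r by lra.
    eapply Rle_trans; [exact H |]. right. unfold Rdiv; ring.
Qed.

Lemma fejer_nonneg (u : R) : 0 <= fejer u.
Proof.
  unfold fejer. destruct (Req_EM_T u 0) as [-> | Hu]; [lra |].
  pose proof (COS_bound u). apply Rdiv_le_0_compat; [lra | now apply pow2_gt_0].
Qed.

Lemma fejer_le (u : R) : u <> 0 -> fejer u <= 2 / u ^ 2.
Proof.
  intros Hu. unfold fejer. destruct (Req_EM_T u 0); [easy |].
  pose proof (COS_bound u).
  apply Rmult_le_compat_r; [left; apply Rinv_0_lt_compat; now apply pow2_gt_0 | lra].
Qed.

Lemma fejer_opp (u : R) : fejer (- u) = fejer u.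
Proof.
  unfold fejer. rewrite cos_neg.
  destruct (Req_EM_T u 0), (Req_EM_T (- u) 0); try lra. f_equal. ring.
Qed.

Lemma fejer_continuous (x : R) : continuous fejer x.
Proof.
  destruct (Req_EM_T x 0) as [-> | Hx].
  - apply continuity_pt_filterlim. intros eps Heps.
    exists (Rmin 1 eps). split; [apply Rmin_pos; lra |].
    intros u [_ Hu]. simpl in *. unfold R_dist in *.
    pose proof (fejer_remainder 0 u) as H. rewrite Rminus_0_r in Hu.
    replace (fejer 0) with (fejer_poly 0 u).
    2:{ unfold fejer, fejer_poly. destruct (Req_EM_T 0 0); [simpl; field | easy]. }
    eapply Rle_lt_trans; [exact H |].
    pose proof (Rmin_l 1 eps). pose proof (Rmin_r 1 eps).
    replace (u ^ (2 * 0 + 2)) with (Rabs u * Rabs u) by (rewrite <- Rabs_mult, Rabs_right; simpl; nra).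
    simpl. pose proof (Rabs_pos u). nra.
  - apply continuous_ext_loc with (fun u => (1 - cos u) / u ^ 2).
    + exists (mkposreal _ (Rabs_pos_lt x Hx)). intros u Hu.
      unfold fejer. destruct (Req_EM_T u 0) as [-> |]; [| easy].
      exfalso. unfold ball in Hu; simpl in Hu. unfold AbsRing_ball, abs, minus, plus, opp in Hu.
      simpl in Hu. rewrite Rplus_0_l, Rabs_Ropp in Hu. lra.
    + apply continuity_pt_filterlim. apply continuity_pt_div.
      * reg.
      * apply derivable_continuous_pt. reg.
      * now apply pow_nonzero.
Qed.

Definition fejer_int (x : R) : R := RInt fejer 0 x.

Lemma is_derive_fejer_int (x : R) : is_derive fejer_int x (fejer x).
Proof.
  apply is_derive_RInt with 0; [| apply fejer_continuous].
  exists (mkposreal 1 Rlt_0_1). intros y _.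
  apply (RInt_correct fejer), ex_RInt_continuous. intros; apply fejer_continuous.
Qed.

Lemma fejer_int_0 : fejer_int 0 = 0.
Proof. apply (RInt_point 0 fejer). Qed.

Lemma fejer_int_incr (x y : R) : x <= y -> fejer_int x <= fejer_int y.
Proof.
  intros H. apply nonneg_derivative_le with fejer; [easy |].
  intros; split; [apply is_derive_fejer_int | apply fejer_nonneg].
Qed.

Lemma fejer_int_opp (x : R) : fejer_int (- x) = - fejer_int x.
Proof.
  assert (D : forall c z, is_derive (fun z => c * (fejer_int z + fejer_int (- z))) z 0).
  { intros c z. replace 0 with (c * (fejer z + -1 * fejer (- z))) by (rewrite fejer_opp; ring).
    apply (is_derive_scal (fun z => fejer_int z + fejer_int (- z))).
    apply (is_derive_plus fejer_int (fun z => fejer_int (- z))); [apply is_derive_fejer_int |].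
    apply (is_derive_comp fejer_int (fun z => - z)); [apply is_derive_fejer_int |].
    auto_derive; [easy | ring]. }
  assert (P : forall z, 0 <= z -> fejer_int z + fejer_int (- z) = 0).
  { intros z Hz.
    pose proof (nonneg_derivative_le _ (fun _ => 0) 0 z Hz (fun z _ => conj (D 1 z) (Rle_refl 0))).
    pose proof (nonneg_derivative_le _ (fun _ => 0) 0 z Hz (fun z _ => conj (D (-1) z) (Rle_refl 0))).
    cbv beta in *. rewrite Ropp_0, fejer_int_0 in *. lra. }
  destruct (Rle_dec 0 x) as [Hx | Hx].
  - specialize (P x Hx). lra.
  - assert (Hx' : 0 <= - x) by lra. specialize (P (- x) Hx'). rewrite Ropp_involutive in P. lra.
Qed.

(** The kernel remainder integrated from 0, giving away the factor [1/(2m+3)]. For each sign [s] the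
    difference [f] vanishes at 0 and has a nonnegative derivative; the two signs give the absolute
    value. *)
Lemma fejer_int_remainder (m : nat) (x : R) :
  Rabs (fejer_int x - fejer_int_poly m x) <= Rabs x ^ (2 * m + 3) / INR (fact (2 * m + 4)).
Proof.
  assert (Hpos : forall x, 0 <= x ->
    Rabs (fejer_int x - fejer_int_poly m x) <= x ^ (2 * m + 3) / INR (fact (2 * m + 4))).
  { clear x. intros x Hx.
    assert (Hs : forall s, Rabs s = 1 -> 0 <= x ^ (2 * m + 3) / INR (fact (2 * m + 4)) -
                               s * (fejer_int x - fejer_int_poly m x)).
    { intros s Hs.
      pose (f := fun x => / INR (fact (2 * m + 4)) * x ^ (2 * (m + 1) + 1) -
                               s * (fejer_int x - fejer_int_poly m x)).
      assert (H0 : f 0 <= f x).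
      { apply (nonneg_derivative_le f (fun x => / INR (fact (2 * m + 4)) *
          INR (2 * (m + 1) + 1) * x ^ (2 * (m + 1)) - s * (fejer x - fejer_poly m x))); [easy |].
        intros z Hz. split.
        - apply (is_derive_minus (fun x => / INR (fact (2 * m + 4)) * x ^ (2 * (m + 1) + 1))).
          + apply is_derive_odd_monomial.
          + apply (is_derive_scal (fun x => fejer_int x - fejer_int_poly m x)).
            apply (is_derive_minus fejer_int);
              [apply is_derive_fejer_int | apply is_derive_fejer_int_poly].
        - pose proof (fejer_remainder m z) as H.
          replace (2 * m + 2)%nat with (2 * (m + 1))%nat in H by lia.
          pose proof (Rle_abs (s * (fejer z - fejer_poly m z))) as H1.
          rewrite Rabs_mult, Hs, Rmult_1_l in H1.
          assert (H2 : 0 <= / INR (fact (2 * m + 4)) * z ^ (2 * (m + 1))).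
          { apply Rmult_le_pos; [left; apply Rinv_0_lt_compat, INR_fact_lt_0 | apply pow_le; lra]. }
          assert (H3 : 1 <= INR (2 * (m + 1) + 1)) by (apply (le_INR 1); lia).
          unfold Rdiv in H. nra. }
      unfold f in H0. rewrite pow_i, fejer_int_0 in H0 by lia.
      replace (fejer_int_poly m 0) with 0 in H0.
      2:{ symmetry; apply sum_eq_R0. intros i _. rewrite pow_i by lia. unfold Rdiv; ring. }
      replace (2 * (m + 1) + 1)%nat with (2 * m + 3)%nat in H0 by lia.
      unfold Rdiv. lra. }
    pose proof (Hs 1 Rabs_R1). pose proof (Hs (-1)) as H1.
    rewrite Rabs_left in H1 by lra. specialize (H1 ltac:(lra)).
    apply Rabs_le. lra. }
  destruct (Rle_dec 0 x) as [Hx | Hx]; [rewrite (Rabs_right x) by lra; now apply Hpos |].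
  rewrite (Rabs_left x) by lra.
  specialize (Hpos (- x)). rewrite fejer_int_opp in Hpos.
  replace (fejer_int_poly m (- x)) with (- fejer_int_poly m x) in Hpos.
  - replace (fejer_int x - fejer_int_poly m x) with
      (- (- fejer_int x - - fejer_int_poly m x)) by ring.
    rewrite Rabs_Ropp. apply Hpos. lra.
  - unfold fejer_int_poly. rewrite <- (Rmult_1_l (sum_f_R0 _ _)), <- Ropp_mult_distr_l_reverse.
    rewrite scal_sum. apply sum_eq. intros i _.
    rewrite !pow_add, pow_even_opp. unfold Rdiv. ring.
Qed.

(** The kernel is at most [2 / u^2], whose integral beyond [x] is [2 / x]. *)
Lemma fejer_int_tail (x y : R) : 0 < x <= y -> fejer_int y <= fejer_int x + 2 / x.
Proof.
  intros Hxy.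
  assert (H : - (2 / x) - fejer_int x <= - (2 / y) - fejer_int y).
  { apply (nonneg_derivative_le (fun x => - (2 / x) - fejer_int x)
      (fun x => 2 / x ^ 2 - fejer x)); [lra |].
    intros z Hz. split.
    - apply (is_derive_minus (fun x => - (2 / x)) fejer_int); [| apply is_derive_fejer_int].
      auto_derive; [lra | field; lra].
    - assert (z <> 0) by lra. pose proof (fejer_le z H). lra. }
  assert (0 < 2 / y) by (apply Rdiv_lt_0_compat; lra). lra.
Qed.

(** [c] is the supremum of [fejer_int] over positive arguments (its value is pi/2), and the tail
    estimate bounds the distance to it. *)
Lemma fejer_int_limit :
  exists c, 0 < c /\ forall x, 0 < x -> fejer_int x <= c <= fejer_int x + 2 / x.
Proof.
  assert (U : forall x y, 0 < x -> 0 < y -> fejer_int y <= fejer_int x + 2 / x).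
  { intros x y Hx Hy. assert (0 < 2 / x) by (apply Rdiv_lt_0_compat; lra).
    destruct (Rle_dec x y); [apply fejer_int_tail; lra |].
    pose proof (fejer_int_incr y x). lra. }
  destruct (completeness (fun v => exists y, 0 < y /\ v = fejer_int y)) as [c [Hc1 Hc2]].
  - exists (fejer_int 1 + 2 / 1). intros v (y & Hy & ->). apply U; lra.
  - exists (fejer_int 1), 1. split; [lra | easy].
  - exists c. split.
    + apply Rlt_le_trans with (fejer_int 1); [| apply Hc1; exists 1; split; [lra | easy]].
      (* The lowest Taylor polynomial gives [fejer_int 1 >= 1/2 - 1/24]. *)
      pose proof (fejer_int_remainder 0 1) as H. apply Rabs_le_between in H.
      rewrite Rabs_R1 in H. unfold fejer_int_poly in H. simpl in H. lra.
    + intros x Hx. split; [apply Hc1; now exists x |].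
      apply Hc2. intros v (y & Hy & ->). now apply U.
Qed.

(** The step [1/2 - fejer_int x / (2c)] falls from 1 to 0. The sign of the kernel confines it to
    [0, 1], the decay of the kernel gives the tails, and the factorial remainder is inherited. *)
Lemma smooth_step :
  exists (h : R -> R) (c : R), 0 < c /\
    (forall x, 0 <= h x <= 1) /\
    (forall x, 0 < x -> h x <= 1 / (c * x)) /\
    (forall x, 0 < x -> 1 - 1 / (c * x) <= h (- x)) /\
    (forall m x, Rabs (h x - (1 / 2 - fejer_int_poly m x / (2 * c))) <=
       Rabs x ^ (2 * m + 3) / INR (fact (2 * m + 4)) / (2 * c)).
Proof.
  destruct fejer_int_limit as (c & Hc & Hlim).
  assert (H1 : forall x, 0 < x -> (c - fejer_int x) / (2 * c) <= 1 / (c * x)).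
  { intros x Hx. specialize (Hlim x Hx).
    replace (1 / (c * x)) with (2 / x / (2 * c)) by (field; lra).
    apply Rmult_le_compat_r; [left; apply Rinv_0_lt_compat; lra | lra]. }
  exists (fun x => 1 / 2 - fejer_int x / (2 * c)), c.
  split; [easy |]. split; [| split; [| split]].
  - assert (B : forall x, 0 < x -> 0 <= fejer_int x / (2 * c) <= 1 / 2).
    { intros x Hx. specialize (Hlim x Hx).
      pose proof (fejer_int_incr 0 x). rewrite fejer_int_0 in H. split.
      - apply Rdiv_le_0_compat; lra.
      - apply (Rmult_le_reg_r (2 * c)); [lra |]. field_simplify; lra. }
    intros x. destruct (Rtotal_order x 0) as [Hx | [-> | Hx]].
    + specialize (B (- x)). rewrite fejer_int_opp in B.
      replace (- fejer_int x / (2 * c)) with (- (fejer_int x / (2 * c))) in B by (field; lra). lra.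
    + rewrite fejer_int_0. unfold Rdiv. lra.
    + specialize (B x Hx). lra.
  - intros x Hx. specialize (H1 x Hx).
    replace ((c - fejer_int x) / (2 * c)) with (1 / 2 - fejer_int x / (2 * c)) in H1 by (field; lra).
    exact H1.
  - intros x Hx. specialize (H1 x Hx). rewrite fejer_int_opp.
    replace (1 / 2 - - fejer_int x / (2 * c)) with (1 - (c - fejer_int x) / (2 * c)) by (field; lra).
    lra.
  - intros m x. pose proof (fejer_int_remainder m x) as H.
    replace (1 / 2 - fejer_int x / (2 * c) - (1 / 2 - fejer_int_poly m x / (2 * c))) with
      (- ((fejer_int x - fejer_int_poly m x) / (2 * c))) by (field; lra).
    rewrite Rabs_Ropp. unfold Rdiv at 1. rewrite Rabs_mult, Rabs_inv, (Rabs_right (2 * c)) by lra.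
    apply Rmult_le_compat_r; [left; apply Rinv_0_lt_compat; lra | exact H].
Qed.

(** * Polynomial sandwich and anticoncentration *)

(* [momval mu f v]: [f] is a polynomial function, and the linear functional sending
   [x^s] to [mu s] sends it to [v]. *)
Inductive momval (mu : nat -> R) : (R -> R) -> R -> Prop :=
| momval_pow s : momval mu (fun x => x ^ s) (mu s)
| momval_lin c f g u v :
    momval mu f u -> momval mu g v -> momval mu (fun x => c * f x + g x) (c * u + v)
| momval_ext f g u : (forall x, f x = g x) -> momval mu f u -> momval mu g u.

Section MomentFunctional.
Variables (mu : nat -> R) (hmu0 : mu 0%nat = 1).

Lemma momval_const (c : R) : momval mu (fun _ => c) c.
Proof.
  assert (H : momval mu (fun x => (c - 1) * x ^ 0 + x ^ 0) ((c - 1) * mu 0%nat + mu 0%nat))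
    by (apply momval_lin; apply momval_pow).
  rewrite hmu0 in H. replace ((c - 1) * 1 + 1) with c in H by ring.
  eapply momval_ext; [| exact H]. intros; simpl; ring.
Qed.

Lemma momval_plus f g u v :
  momval mu f u -> momval mu g v -> momval mu (fun x => f x + g x) (u + v).
Proof.
  intros Hf Hg. apply momval_ext with (fun x => 1 * f x + g x); [intros; ring |].
  replace (u + v) with (1 * u + v) by ring. now apply momval_lin.
Qed.

Lemma momval_scal c f u : momval mu f u -> momval mu (fun x => c * f x) (c * u).
Proof.
  intros Hf. apply momval_ext with (fun x => c * f x + 0); [intros; ring |].
  replace (c * u) with (c * u + 0) by ring. apply momval_lin; [easy | apply momval_const].
Qed.

Lemma momval_mult_affine f u a b :
  momval mu f u -> exists v, momval mu (fun x => (a * x + b) * f x) v.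
Proof.
  intros Hf.
  assert (H : exists v, momval mu (fun x => x * f x) v).
  { induction Hf as [s | c f g u v Hf [u' IHf] Hg [v' IHg] | f g u E Hf [u' IHf]].
    - exists (mu (S s)). exact (momval_pow mu (S s)).
    - exists (c * u' + v').
      apply momval_ext with (fun x => c * (x * f x) + x * g x); [intros; ring |].
      now apply momval_lin.
    - exists u'. apply momval_ext with (fun x => x * f x); [intros; now rewrite E | easy]. }
  destruct H as [v Hv]. exists (a * v + b * u).
  apply momval_ext with (fun x => a * (x * f x) + b * f x); [intros; ring |].
  apply momval_lin; [easy | now apply momval_scal].
Qed.

Lemma momval_affine_pow a b s : exists v, momval mu (fun x => (a * x + b) ^ s) v.
Proof.
  induction s as [|s [u IH]].
  - exists 1. exact (momval_const 1).
  - now apply momval_mult_affine with u.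
Qed.

Lemma momval_fejer_int_poly m a b :
  exists v, momval mu (fun x => fejer_int_poly m (a * x + b)) v.
Proof.
  unfold fejer_int_poly.
  assert (H : forall i, exists v, momval mu (fun x => (-1) ^ i * (a * x + b) ^ (2 * i + 1) /
             (INR (2 * i + 1) * INR (fact (2 * i + 2)))) v).
  { intros i. destruct (momval_affine_pow a b (2 * i + 1)) as [v Hv].
    set (d := INR (2 * i + 1) * INR (fact (2 * i + 2))).
    exists ((-1) ^ i / d * v).
    apply momval_ext with (fun x => (-1) ^ i / d * (a * x + b) ^ (2 * i + 1));
      [intros; unfold Rdiv; ring |].
    now apply momval_scal. }
  induction m as [|m [u IH]]; [apply (H 0%nat) |].
  destruct (H (S m)) as [v Hv]. exists (u + v). now apply (momval_plus _ _ u v).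
Qed.

(** Double the larger of the two absolute values. This majorises an even power of [x - a] by a
    polynomial without cross terms, whose moment value is explicit. *)
Lemma even_pow_add_le (x y : R) (j : nat) :
  (x + y) ^ (2 * j) <= 2 ^ (2 * j) * (x ^ (2 * j) + y ^ (2 * j)).
Proof.
  assert (E : forall z, z ^ (2 * j) = Rabs z ^ (2 * j)).
  { intros z. now rewrite !pow_mult, pow2_abs. }
  rewrite (E (x + y)), (E x), (E y).
  pose proof (Rabs_pos x). pose proof (Rabs_pos y). pose proof (Rabs_triang x y).
  pose proof (Rabs_pos (x + y)).
  assert (P : forall u v, 0 <= u -> u <= v -> 0 <= v -> (u + v) ^ (2 * j) <=
     2 ^ (2 * j) * (u ^ (2 * j) + v ^ (2 * j))).
  { intros u v Hu Huv Hv. apply Rle_trans with ((2 * v) ^ (2 * j)).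
    - apply pow_incr. lra.
    - rewrite Rpow_mult_distr. apply Rmult_le_compat_l; [apply pow_le; lra |].
      pose proof (pow_le u (2 * j) Hu). lra. }
  eapply Rle_trans; [apply pow_incr; split; [lra | exact H1] |].
  destruct (Rle_dec (Rabs x) (Rabs y)); [now apply P |].
  rewrite (Rplus_comm (Rabs x)), (Rplus_comm (Rabs x ^ _)). apply P; lra.
Qed.

(* The step has exponential type, so moments that are [o(s! / T^s)] for every [T] make
   its Taylor polynomials accurate in mean. *)
Lemma polynomial_sandwich :
  (forall s, 0 <= mu s) ->
  (forall T eps, 1 <= T -> 0 < eps -> exists m,
     T ^ (2 * m + 4) * (1 + mu (2 * m + 4)%nat) / INR (fact (2 * m + 4)) < eps) ->
  forall a delta eps, 0 < delta -> 0 < eps ->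
  exists q r u v, momval mu q u /\ momval mu r v /\ u - v <= eps /\
    (forall x, 0 <= q x) /\ (forall x, x <= a - delta -> 1 <= q x) /\
    (forall x, r x <= 1) /\ (forall x, a + delta <= x -> r x <= 0).
Proof.
  intros Hmu Hgr a delta eps Hd He.
  destruct smooth_step as (h & c & Hc & H01 & Hpos & Hneg & Htay).
  (* The budget: [u - v] will be [2 L] with [L <= 2 e]. The stretching factor [T] is the one for
     which the tail of the step at distance [delta] equals [e]. *)
  set (e := eps / 4). assert (He' : 0 < e) by (unfold e; lra).
  set (T := 1 / (c * delta * e)).
  assert (HT : 0 < T).
  { apply Rdiv_lt_0_compat; [lra |]. apply Rmult_lt_0_compat; [now apply Rmult_lt_0_compat | easy]. }
  (* Dominates 1, [2 T] and [2 T |a|], hence all three parts of the mean Taylor error. *)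
  set (R0 := 1 + 2 * T + 2 * T * Rabs a).
  pose proof (Rabs_pos a) as Ha.
  assert (HTa : 0 <= T * Rabs a) by (apply Rmult_le_pos; lra).
  destruct (Hgr R0 (c * e)) as [m Hm]; [unfold R0; lra | now apply Rmult_lt_0_compat |].
  set (j := (m + 2)%nat). replace (2 * m + 4)%nat with (2 * j)%nat in * by (unfold j; lia).
  set (M := mu (2 * j)%nat) in *. pose proof (Hmu (2 * j)%nat) as HM. fold M in HM.
  set (D := 1 / INR (fact (2 * j)) / (2 * c)).
  assert (HD : 0 < D).
  { unfold D. apply Rdiv_lt_0_compat; [apply Rdiv_lt_0_compat; [lra | apply INR_fact_lt_0] | lra]. }
  destruct (momval_fejer_int_poly m T (- (T * a))) as [w Hw].
  (* [e] pays for the tails of the step. The rest is a polynomial above the Taylor error at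
     [z = T (x - a)]: the odd power of [|z|] is not a polynomial, so it is replaced by [1 + z^(2j)],
     and this is then spread over [x] and [a]. *)
  set (err := fun x => e + D * (1 + (2 * T) ^ (2 * j) * (x ^ (2 * j) + a ^ (2 * j)))).
  set (L := e + D * (1 + (2 * T) ^ (2 * j) * (M + a ^ (2 * j)))).
  assert (Herr : momval mu err L).
  { apply momval_ext with (fun x => D * (2 * T) ^ (2 * j) * x ^ (2 * j) +
      (e + D * (1 + (2 * T) ^ (2 * j) * a ^ (2 * j)))); [intros; unfold err; ring |].
    replace L with (D * (2 * T) ^ (2 * j) * M + (e + D * (1 + (2 * T) ^ (2 * j) * a ^ (2 * j))))
      by (unfold L; ring).
    apply momval_lin; [apply momval_pow | apply momval_const]. }
  set (p := fun x => 1 / 2 - fejer_int_poly m (T * x + - (T * a)) / (2 * c)).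
  assert (Hp : momval mu p (1 / 2 - w / (2 * c))).
  { apply momval_ext with (fun x => - (1 / (2 * c)) * fejer_int_poly m (T * x + - (T * a)) + 1 / 2).
    - intros; unfold p; field; lra.
    - replace (1 / 2 - w / (2 * c)) with (- (1 / (2 * c)) * w + 1 / 2) by (field; lra).
      apply momval_lin; [easy | apply momval_const]. }
  assert (Hclose : forall x, Rabs (h (T * x + - (T * a)) - p x) <= err x - e).
  { intros x. unfold p, err. cbv beta.
    replace (T * x + - (T * a)) with (T * (x - a)) by ring. set (z := T * (x - a)).
    eapply Rle_trans; [apply Htay |].
    replace (2 * m + 4)%nat with (2 * j)%nat by (unfold j; lia).
    replace (Rabs z ^ (2 * m + 3) / INR (fact (2 * j)) / (2 * c)) with (D * Rabs z ^ (2 * m + 3))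
      by (unfold D; unfold Rdiv; ring).
    assert (Hz : Rabs z ^ (2 * m + 3) <= 1 + z ^ (2 * j)).
    { replace (z ^ (2 * j)) with (Rabs z ^ (2 * j)) by (now rewrite !pow_mult, pow2_abs).
      replace (2 * j)%nat with (S (2 * m + 3)) by (unfold j; lia).
      pose proof (Rabs_pos z) as Hz0. pose proof (pow_le _ (2 * m + 3) Hz0).
      destruct (Rle_dec (Rabs z) 1) as [H1 | H1].
      - assert (Rabs z ^ (2 * m + 3) <= 1) by (rewrite <- (pow1 (2 * m + 3)); apply pow_incr; lra).
        pose proof (pow_le _ (S (2 * m + 3)) Hz0). lra.
      - rewrite <- tech_pow_Rmult. nra. }
    assert (Hz2 : z ^ (2 * j) <= (2 * T) ^ (2 * j) * (x ^ (2 * j) + a ^ (2 * j))).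
    { unfold z. pose proof (even_pow_add_le x (- a) j) as H.
      rewrite (pow_even_opp a) in H. rewrite Rpow_mult_distr, (Rpow_mult_distr 2 T).
      assert (0 <= T ^ (2 * j)) by (apply pow_le; lra).
      eapply Rle_trans; [apply Rmult_le_compat_l; [easy | exact H] |]. right. ring. }
    assert (D * Rabs z ^ (2 * m + 3) <= D * (1 + (2 * T) ^ (2 * j) * (x ^ (2 * j) + a ^ (2 * j)))).
    { apply Rmult_le_compat_l; lra. }
    lra. }
  assert (HTd : 1 / (c * (T * delta)) = e).
  { unfold T. field. repeat split; lra. }
  (* The Taylor polynomial plus and minus its error; the inexplicit value [w] cancels in [u - v]. *)
  exists (fun x => p x + err x), (fun x => -1 * err x + p x),
    (1 / 2 - w / (2 * c) + L), (-1 * L + (1 / 2 - w / (2 * c))).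
  split; [now apply momval_plus |]. split; [now apply momval_lin |].
  assert (Hcl : forall x, h (T * x + - (T * a)) - (err x - e) <= p x
                          <= h (T * x + - (T * a)) + (err x - e)).
  { intros x. specialize (Hclose x). apply Rabs_le_between in Hclose. lra. }
  assert (Hfar : forall x y, delta <= x - y -> 1 / (c * (T * (x - y))) <= e).
  { intros x y Hxy. rewrite <- HTd.
    assert (Hm1 : T * delta <= T * (x - y)) by (apply Rmult_le_compat_l; lra).
    assert (0 < T * delta) by (apply Rmult_lt_0_compat; lra).
    assert (c * (T * delta) <= c * (T * (x - y))) by (apply Rmult_le_compat_l; lra).
    assert (0 < c * (T * delta)) by (apply Rmult_lt_0_compat; lra).
    unfold Rdiv. rewrite !Rmult_1_l. now apply Rinv_le_contravar. }
  split; [| split; [| split; [| split]]].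
  - assert (HL : L <= 2 * e); [| unfold e in *; lra].
    assert (B1 : (2 * T) ^ (2 * j) <= R0 ^ (2 * j)) by (apply pow_incr; unfold R0; lra).
    assert (B2 : (2 * T) ^ (2 * j) * a ^ (2 * j) <= R0 ^ (2 * j)).
    { replace (a ^ (2 * j)) with (Rabs a ^ (2 * j)) by (now rewrite !pow_mult, pow2_abs).
      rewrite <- Rpow_mult_distr. apply pow_incr. unfold R0.
      split; [apply Rmult_le_pos; lra | lra]. }
    assert (B3 : 1 <= R0 ^ (2 * j)) by (apply pow_R1_Rle; unfold R0; lra).
    assert (B4 : 1 + (2 * T) ^ (2 * j) * (M + a ^ (2 * j)) <= 2 * (R0 ^ (2 * j) * (1 + M))) by nra.
    assert (B5 : D * (1 + (2 * T) ^ (2 * j) * (M + a ^ (2 * j))) <=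
      D * (2 * (R0 ^ (2 * j) * (1 + M)))) by (apply Rmult_le_compat_l; lra).
    replace (D * (2 * (R0 ^ (2 * j) * (1 + M)))) with
      (R0 ^ (2 * j) * (1 + M) / INR (fact (2 * j)) / c) in B5
      by (unfold D; pose proof (INR_fact_neq_0 (2 * j)); field; split; [easy | lra]).
    assert (B6 : R0 ^ (2 * j) * (1 + M) / INR (fact (2 * j)) / c <= e).
    { apply (Rmult_le_reg_r c); [easy |]. unfold Rdiv at 1.
      rewrite Rmult_assoc, Rinv_l by lra. lra. }
    unfold L. lra.
  - intros x. specialize (Hcl x). specialize (H01 (T * x + - (T * a))). lra.
  - intros x Hx. specialize (Hcl x).
    specialize (Hfar a x ltac:(lra)).
    assert (0 < T * (a - x)) by (apply Rmult_lt_0_compat; lra).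
    specialize (Hneg (T * (a - x)) H).
    replace (- (T * (a - x))) with (T * x + - (T * a)) in Hneg by ring. lra.
  - intros x. specialize (Hcl x). specialize (H01 (T * x + - (T * a))). lra.
  - intros x Hx. specialize (Hcl x).
    specialize (Hfar x a ltac:(lra)).
    assert (0 < T * (x - a)) by (apply Rmult_lt_0_compat; lra).
    specialize (Hpos (T * (x - a)) H).
    replace (T * (x - a)) with (T * x + - (T * a)) in Hpos by ring.
    replace (T * x + - (T * a)) with (T * (x - a)) in Hpos at 2 by ring. lra.
Qed.

End MomentFunctional.

(** * Growth of the limit moments and size of the largest atom *)

Section Limit.
Variables (k : nat) (hk : (1 <= k)%nat).

Lemma Y0_moment_0 : Y0_moment k 0 = 1.
Proof.
  pose proof (INR_k_ge_1 k hk).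
  rewrite Y0_moment_risingR by easy. simpl. rewrite Rmult_0_r, Rplus_0_l.
  assert (0 < Gamma (1 / INR (k + 1))).
  { apply Gamma_pos. rewrite INR_k_plus_1. apply Rdiv_lt_0_compat; lra. }
  field. lra.
Qed.

Lemma risingR_fact_lower (a : R) (m : nat) :
  0 < a -> a * INR (fact m) <= risingR a (S m).
Proof.
  intros Ha. induction m as [|m IH]; [simpl; lra |].
  change (risingR a (S (S m))) with (risingR a (S m) * (a + INR (S m))).
  rewrite fact_simpl, mult_INR. pose proof (pos_INR (S m)). pose proof (INR_fact_lt_0 m).
  assert (0 < a * INR (fact m)) by (apply Rmult_lt_0_compat; lra). nra.
Qed.

Lemma risingR_fact_upper (a : R) (m : nat) : 0 < a <= 1 -> risingR a m <= INR (fact m).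
Proof.
  intros Ha. induction m as [|m IH]; [simpl; lra |].
  change (risingR a (S m)) with (risingR a m * (a + INR m)).
  rewrite fact_simpl, mult_INR, S_INR. pose proof (pos_INR m).
  pose proof (risingR_pos a m ltac:(lra)). nra.
Qed.

(* Along [s = 2(k+1)i] the Gamma factor in the denominator is [Gamma (2ki + 1/(k+1))],
   an integer shift of the one in the numerator. *)
Lemma Y0_moment_growth (T eps : R) :
  1 <= T -> 0 < eps -> exists m,
  T ^ (2 * m + 4) * (1 + Y0_moment k (2 * m + 4)) / INR (fact (2 * m + 4)) < eps.
Proof.
  intros HT He. pose proof (INR_k_ge_1 k hk) as Hk.
  set (a := 1 / INR (k + 1)).
  assert (Ha : 0 < a) by (unfold a; rewrite INR_k_plus_1; apply Rdiv_lt_0_compat; lra).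
  assert (HTT : 1 <= T * T) by nra.
  assert (Ha2 : 0 < a * eps / (2 * (T * T))).
  { apply Rdiv_lt_0_compat; [now apply Rmult_lt_0_compat | lra]. }
  destruct (cv_speed_pow_fact (T * T) _ Ha2) as [N1 HN1].
  destruct (cv_speed_pow_fact T (eps / 2)) as [N2 HN2]; [lra |].
  set (i := S (N1 + N2)). set (n := pred (2 * k * i)).
  assert (En : S n = (2 * k * i)%nat) by (unfold n, i; nia).
  exists ((k + 1) * i - 2)%nat.
  assert (Es : (2 * ((k + 1) * i - 2) + 4 = 2 * (k + 1) * i)%nat) by (unfold i; nia).
  rewrite Es. set (s := (2 * (k + 1) * i)%nat) in *.
  (* Since [k + 1 <= 2k], the power [T^s] can be compared with [n!] through the base [T^2]. *)
  assert (Hs : (s <= 2 * S n)%nat) by (unfold s; rewrite En; nia).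
  assert (HTs : T ^ s <= (T * T) ^ S n).
  { replace (T * T) with (T ^ 2) by ring. rewrite <- pow_mult. now apply Rle_pow. }
  (* The numerator [risingR (1/k) s] is at most [s!] because [1/k <= 1]. The quotient of Gamma
     values is the inverse of [risingR a (S n)], which is at least [a n!]. *)
  assert (Hmom : Y0_moment k s / INR (fact s) <= / (a * INR (fact n))).
  { rewrite Y0_moment_risingR by easy. fold a.
    replace (kap k * INR s + a) with (a + INR (S n)).
    2:{ rewrite En. unfold s, kap. rewrite !mult_INR, INR_k_plus_1. simpl (INR 2).
        rewrite Rplus_comm. f_equal. field. lra. }
    rewrite Gamma_plus_nat by easy.
    pose proof (Gamma_pos a Ha). pose proof (risingR_pos a (S n) Ha).
    pose proof (risingR_fact_lower a n Ha). pose proof (INR_fact_lt_0 n).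
    pose proof (INR_fact_lt_0 s).
    assert (Hk' : 0 < 1 / INR k <= 1).
    { split; [apply Rdiv_lt_0_compat; lra |]. apply (Rmult_le_reg_r (INR k)); [lra |].
      field_simplify; lra. }
    pose proof (risingR_fact_upper (1 / INR k) s Hk').
    replace (_ / INR (fact s)) with (risingR (1 / INR k) s / INR (fact s) * / risingR a (S n))
      by (field; repeat split; lra).
    rewrite <- (Rmult_1_l (/ (a * INR (fact n)))).
    apply Rmult_le_compat.
    - apply Rdiv_le_0_compat; [left; now apply risingR_pos | lra].
    - left; now apply Rinv_0_lt_compat.
    - apply (Rmult_le_reg_r (INR (fact s))); [easy |]. field_simplify; lra.
    - apply Rinv_le_contravar; [now apply Rmult_lt_0_compat | easy]. }
  assert (H1 : T ^ s / INR (fact s) < eps / 2).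
  { assert (Hn : (s >= N2)%nat) by (unfold s, i; nia).
    specialize (HN2 s Hn). unfold Rdist in HN2. rewrite Rminus_0_r in HN2.
    apply Rabs_def2 in HN2. lra. }
  assert (H2 : T ^ s * (Y0_moment k s / INR (fact s)) < eps / 2).
  { assert (Hn : (n >= N1)%nat) by (unfold n, i; nia).
    specialize (HN1 n Hn). unfold Rdist in HN1. rewrite Rminus_0_r in HN1.
    apply Rabs_def2 in HN1. destruct HN1 as [HN1 _].
    pose proof (INR_fact_lt_0 n).
    assert (0 < / (a * INR (fact n))) by (apply Rinv_0_lt_compat, Rmult_lt_0_compat; lra).
    assert (0 <= T ^ s) by (apply pow_le; lra).
    apply Rle_lt_trans with ((T * T) ^ S n * / (a * INR (fact n))).
    - apply Rle_trans with (T ^ s * / (a * INR (fact n))).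
      + now apply Rmult_le_compat_l.
      + apply Rmult_le_compat_r; lra.
    - replace ((T * T) ^ S n * / (a * INR (fact n))) with
        ((T * T) ^ n / INR (fact n) * (T * T / a)) by (simpl; field; split; lra).
      apply Rlt_le_trans with (a * eps / (2 * (T * T)) * (T * T / a)).
      + apply Rmult_lt_compat_r; [apply Rdiv_lt_0_compat; lra | easy].
      + right. field. split; lra. }
  replace (T ^ s * (1 + Y0_moment k s) / INR (fact s)) with
    (T ^ s / INR (fact s) + T ^ s * (Y0_moment k s / INR (fact s))) by (unfold Rdiv; ring).
  lra.
Qed.

Lemma pmf_1_0 : pmf k 1 0 = 0.
Proof. rewrite pmf_S_0 by easy. simpl (INR 0). rewrite Rmult_0_r. unfold Rdiv; ring. Qed.

(** Node 1 is attached to the root-clique, so the out-degree is positive from size 1 on. This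
    settles the value [m = 0] in the atom bound, where for [k > 1] the factor in [pmf_S_0] decays
    too slowly. *)
Lemma pmf_S_n_0 (n : nat) : pmf k (S n) 0 = 0.
Proof.
  induction n as [|n IH]; [apply pmf_1_0 |]. rewrite pmf_S_0, IH by easy. ring.
Qed.

(** The product of [1 - k / (1 + (k+1) j)] over [j = 1, ..., n], written as a ratio of rising
    factorials so that [risingR_ratio_lim] gives its order. *)
Definition decay (n : nat) : R :=
  risingR (2 / INR (k + 1)) n / risingR (1 / INR (k + 1) + 1) n.

Lemma decay_params : 0 < 2 / INR (k + 1) /\ 0 < 1 / INR (k + 1) + 1.
Proof.
  pose proof (INR_k_ge_1 k hk) as Hk. rewrite INR_k_plus_1.
  split; [apply Rdiv_lt_0_compat; lra |].
  assert (0 < 1 / (INR k + 1)) by (apply Rdiv_lt_0_compat; lra). lra.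
Qed.

Lemma decay_pos (n : nat) : 0 < decay n.
Proof. destruct decay_params. apply Rdiv_lt_0_compat; now apply risingR_pos. Qed.

Lemma decay_S (n : nat) :
  decay (S n) = decay n *
    ((1 + (INR k + 1) * INR (S n) - INR k) / (1 + (INR k + 1) * INR (S n))).
Proof.
  pose proof (INR_k_ge_1 k hk) as Hk. destruct decay_params as [H1 H2].
  pose proof (risingR_pos _ n H2). pose proof (pos_INR n).
  unfold decay in *. cbn [risingR]. rewrite INR_k_plus_1, S_INR in *.
  assert (0 < 1 + (1 + INR n) * (INR k + 1)) by nra.
  field. repeat split; try lra; nra.
Qed.

(* The two coefficients of the recurrence for [pmf] sum to [1 - k / (1 + (k+1) n)];
   they are nonnegative only for [n >= k]. *)
Lemma pmf_le_decay (r m : nat) :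
  pmf k (k + r) m <= decay (k - 1 + r) / decay (k - 1).
Proof.
  pose proof (INR_k_ge_1 k hk) as Hk. pose proof (decay_pos (k - 1)) as Hd0.
  revert m. induction r as [|r IH]; intros m.
  - rewrite !Nat.add_0_r. unfold Rdiv. rewrite Rinv_r by lra.
    apply Rle_trans with (Ex k k (fun _ => 1)); [| rewrite Ex_const by easy; lra].
    apply Ex_le; [easy |]. intros y. apply indic_bounds.
  (* The passage from size [n] to [n + 1] costs the factor of index [n] in [decay], whence the
     offset [k - 1] against the starting size [k]. *)
  - rewrite !Nat.add_succ_r, decay_S.
    replace (S (k - 1 + r)) with (k + r)%nat by lia.
    set (n := (k + r)%nat) in *.
    set (D := decay (k - 1 + r) / decay (k - 1)) in *.
    assert (HD : 0 < D) by (apply Rdiv_lt_0_compat; [apply decay_pos | easy]).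
    assert (Hn : INR k <= INR n) by (apply le_INR; lia).
    pose proof (total_slots_pos k n) as Hw. set (w := 1 + (INR k + 1) * INR n) in *.
    replace (decay (k - 1 + r) * ((w - INR k) / w) / decay (k - 1)) with (D * ((w - INR k) / w))
      by (unfold D; field; lra).
    assert (HD2 : 0 <= D * ((w - INR k) / w)).
    { apply Rmult_le_pos; [lra |]. apply Rdiv_le_0_compat; [unfold w; nra | easy]. }
    destruct m as [|m].
    { unfold n. rewrite pmf_S_n_0. exact HD2. }
    (* For [m <= n] the second coefficient has numerator at least [(k+1) n - k (n+1) = n - k >= 0];
       beyond that, [m + 1] lies outside the support. *)
    destruct (le_lt_dec m n) as [Hm | Hm]; [| rewrite pmf_gt by lia; exact HD2].
    rewrite pmf_S_S by easy. fold w.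
    apply le_INR in Hm. rewrite S_INR. pose proof (pos_INR m).
    assert (0 <= (1 + INR k * INR m) / w) by (apply Rdiv_le_0_compat; [nra | easy]).
    assert (0 <= ((INR k + 1) * INR n - INR k * (INR m + 1)) / w)
      by (apply Rdiv_le_0_compat; [nra | easy]).
    replace (D * ((w - INR k) / w)) with ((1 + INR k * INR m) / w * D +
      ((INR k + 1) * INR n - INR k * (INR m + 1)) / w * D)
      by (unfold w; field; fold w; lra).
    apply Rplus_le_compat; (apply Rmult_le_compat_l; [easy | apply IH]).
Qed.

(** The parameters of [decay] differ by [k/(k+1)], so [decay n] is of order [n^(-k/(k+1))], which is
    [scale k n]. *)
Lemma pmf_le_scale :
  exists K, 0 < K /\ eventually (fun n => forall m, pmf k n m <= K * scale k n).
Proof.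
  pose proof (INR_k_ge_1 k hk) as Hk. destruct decay_params as [H1 H2].
  pose proof (risingR_ratio_lim _ _ H2 H1) as HL.
  set (l := Gamma _ / Gamma _) in HL.
  apply is_lim_seq_Reals in HL. destruct (HL 1 Rlt_0_1) as [N HN].
  pose proof (decay_pos (k - 1)) as Hd0.
  assert (HK : 0 < Rabs l + 1) by (pose proof (Rabs_pos l); lra).
  exists (2 * ((Rabs l + 1) / decay (k - 1))). split.
  { apply Rmult_lt_0_compat; [lra |]. now apply Rdiv_lt_0_compat. }
  exists (N + k + 2)%nat. intros n Hn m.
  replace n with (k + (n - k))%nat at 1 by lia.
  eapply Rle_trans; [apply pmf_le_decay |].
  replace (k - 1 + (n - k))%nat with (n - 1)%nat by lia.
  (* Trades the index [n - 1] for [n], to read off the order directly in terms of [scale k n]. *)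
  assert (Hd : decay (n - 1) <= 2 * decay n).
  { replace n with (S (n - 1)) at 2 by lia. rewrite decay_S.
    replace (S (n - 1)) with n by lia.
    pose proof (decay_pos (n - 1)). pose proof (total_slots_pos k n) as Hw.
    assert (2 <= INR n) by (apply (le_INR 2); lia).
    assert (1 / 2 <= (1 + (INR k + 1) * INR n - INR k) / (1 + (INR k + 1) * INR n)).
    { apply (Rmult_le_reg_r (1 + (INR k + 1) * INR n)); [easy |]. unfold Rdiv at 2.
      rewrite Rmult_assoc, Rinv_l by lra. nra. }
    nra. }
  assert (Hs : decay n <= (Rabs l + 1) * scale k n).
  { specialize (HN n ltac:(lia)). unfold Rdist in HN. fold (decay n) in HN.
    replace (1 / INR (k + 1) + 1 - 2 / INR (k + 1)) with (kap k) in HN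
      by (unfold kap; rewrite INR_k_plus_1; field; lra).
    apply Rabs_def2 in HN. pose proof (Rle_abs l).
    assert (Hsc : Rpower (INR n) (kap k) * scale k n = 1).
    { unfold scale. rewrite <- Rpower_plus, Rplus_opp_r. apply Rpower_O, lt_0_INR. lia. }
    pose proof (scale_pos k n).
    replace (decay n) with (decay n * Rpower (INR n) (kap k) * scale k n)
      by (rewrite Rmult_assoc, Hsc; ring).
    apply Rmult_le_compat_r; lra. }
  apply Rle_trans with (2 * ((Rabs l + 1) * scale k n) / decay (k - 1)).
  - apply Rmult_le_compat_r; [left; now apply Rinv_0_lt_compat | lra].
  - right. field. lra.
Qed.

End Limit.

(** * The limit law *)

Lemma is_lim_seq_le_eventually (u : nat -> R) (l c : R) :
  is_lim_seq u l -> eventually (fun n => u n <= c) -> l <= c.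
Proof.
  intros Hu He. assert (H : Rbar_le l c); [| exact H].
  eapply is_lim_seq_le_loc; [exact He | exact Hu | apply is_lim_seq_const].
Qed.

Lemma is_lim_seq_ge_eventually (u : nat -> R) (l c : R) :
  is_lim_seq u l -> eventually (fun n => c <= u n) -> c <= l.
Proof.
  intros Hu He. assert (H : Rbar_le c l); [| exact H].
  eapply is_lim_seq_le_loc; [exact He | apply is_lim_seq_const | exact Hu].
Qed.

Lemma is_lim_seq_lt_eventually (u : nat -> R) (l c : R) :
  is_lim_seq u l -> l < c -> eventually (fun n => u n < c).
Proof.
  intros Hu Hc. apply is_lim_seq_Reals in Hu.
  destruct (Hu (c - l)) as [N HN]; [lra |]. exists N. intros n Hn.
  specialize (HN n Hn). unfold Rdist in HN. apply Rabs_def2 in HN. lra.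
Qed.

Lemma is_lim_seq_gt_eventually (u : nat -> R) (l c : R) :
  is_lim_seq u l -> c < l -> eventually (fun n => c < u n).
Proof.
  intros Hu Hc. apply is_lim_seq_Reals in Hu.
  destruct (Hu (l - c)) as [N HN]; [lra |]. exists N. intros n Hn.
  specialize (HN n Hn). unfold Rdist in HN. apply Rabs_def2 in HN. lra.
Qed.

Lemma is_lim_seq_sum_f_R0 (f : nat -> nat -> R) (l : nat -> R) (N : nat) :
  (forall i, is_lim_seq (f i) (l i)) ->
  is_lim_seq (fun n => sum_f_R0 (fun i => f i n) N) (sum_f_R0 l N).
Proof.
  intros H. induction N as [|N IH]; simpl; [apply H |].
  apply is_lim_seq_plus'; [exact IH | apply H].
Qed.

Lemma sum_f_R0_ge_term (f : nat -> R) (n i : nat) :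
  (forall j, 0 <= f j) -> (i <= n)%nat -> f i <= sum_f_R0 f n.
Proof.
  intros Hf Hi. induction n as [|n IH].
  - replace i with 0%nat by lia. simpl; lra.
  - simpl. destruct (Nat.eq_dec i (S n)) as [-> | Hne].
    + pose proof (cond_pos_sum f n Hf). lra.
    + specialize (IH ltac:(lia)). pose proof (Hf (S n)). lra.
Qed.

Lemma sum_f_R0_telescope (u : nat -> R) (n : nat) :
  sum_f_R0 (fun i => u (S i) - u i) n = u (S n) - u 0%nat.
Proof. induction n as [|n IH]; simpl; [easy | rewrite IH; ring]. Qed.

(** * Riemann-Stieltjes sums over uniform grids *)

Definition grid (a b : R) (N i : nat) : R := a + INR i * (b - a) / INR (S N).

Lemma grid_bounds (a b : R) (N i : nat) :
  a <= b -> (i <= S N)%nat -> a <= grid a b N i <= b.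
Proof.
  intros Hab Hi. unfold grid.
  assert (0 < INR (S N)) by (apply lt_0_INR; lia).
  apply le_INR in Hi. pose proof (pos_INR i). split.
  - assert (0 <= INR i * (b - a) / INR (S N)); [| lra].
    apply Rdiv_le_0_compat; [apply Rmult_le_pos; lra | easy].
  - assert (INR i * (b - a) / INR (S N) <= b - a); [| lra].
    apply (Rmult_le_reg_r (INR (S N))); [easy |]. unfold Rdiv.
    rewrite Rmult_assoc, Rinv_l by lra. nra.
Qed.

Lemma grid_S (a b : R) (N i : nat) :
  grid a b N (S i) = grid a b N i + (b - a) / INR (S N).
Proof. unfold grid. rewrite (S_INR i). unfold Rdiv. ring. Qed.

Lemma grid_step_nonneg (a b : R) (N : nat) : a <= b -> 0 <= (b - a) / INR (S N).
Proof. intros H. apply Rdiv_le_0_compat; [lra | apply lt_0_INR; lia]. Qed.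

Lemma grid_0 (a b : R) (N : nat) : grid a b N 0 = a.
Proof. unfold grid. simpl (INR 0). unfold Rdiv. ring. Qed.

Lemma grid_last (a b : R) (N : nat) : grid a b N (S N) = b.
Proof. unfold grid. field. apply not_0_INR. lia. Qed.

(** Reduces a bound on a whole Stieltjes sum to an inequality on each cell; [phi] acts as the
    cumulative integral. *)
Lemma RS_sum_le_telescope (g F phi : R -> R) (a b : R) (N : nat) :
  (forall i, (i <= N)%nat ->
     g (grid a b N i) * (F (grid a b N (S i)) - F (grid a b N i)) <=
     phi (grid a b N (S i)) - phi (grid a b N i)) ->
  RS_sum g F a b N <= phi b - phi a.
Proof.
  intros H.
  apply Rle_trans with (sum_f_R0 (fun i => phi (grid a b N (S i)) - phi (grid a b N i)) N).
  - apply sum_Rle. exact H.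
  - rewrite (sum_f_R0_telescope (fun i => phi (grid a b N i))), grid_0, grid_last. lra.
Qed.

Lemma RS_sum_lin (c : R) (f g F : R -> R) (a b : R) (N : nat) :
  RS_sum (fun x => c * f x + g x) F a b N = c * RS_sum f F a b N + RS_sum g F a b N.
Proof.
  rewrite <- (Rmult_1_l (RS_sum g F a b N)). unfold RS_sum. rewrite <- sum_f_R0_lin. apply sum_eq. intros. ring.
Qed.

Lemma RS_sum_opp (g F : R -> R) (a b : R) (N : nat) :
  RS_sum (fun x => - g x) F a b N = - RS_sum g F a b N.
Proof.
  assert (E : forall s, s = -1 * RS_sum g F a b N + 0 * RS_sum g F a b N -> s = - RS_sum g F a b N)
    by (intros; lra).
  apply E. unfold RS_sum. rewrite <- sum_f_R0_lin. apply sum_eq. intros. ring.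
Qed.

Lemma RS_sum_ge_telescope (g F phi : R -> R) (a b : R) (N : nat) :
  (forall i, (i <= N)%nat ->
     phi (grid a b N (S i)) - phi (grid a b N i) <=
     g (grid a b N i) * (F (grid a b N (S i)) - F (grid a b N i))) ->
  phi b - phi a <= RS_sum g F a b N.
Proof.
  intros H.
  assert (H1 : RS_sum (fun x => - g x) F a b N <= - phi b - - phi a).
  { apply (RS_sum_le_telescope _ F (fun x => - phi x)). intros i Hi. specialize (H i Hi). lra. }
  rewrite RS_sum_opp in H1. lra.
Qed.

Lemma RS_sum_ext (f g F : R -> R) (a b : R) (N : nat) :
  (forall x, f x = g x) -> RS_sum f F a b N = RS_sum g F a b N.
Proof. intros H. apply sum_eq. intros. now rewrite H. Qed.

(** The distribution function of a unit mass at [t]; [scaled_cdf] is an average of these. *)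
Definition step (t x : R) : R := if Rle_dec t x then 1 else 0.

Lemma step_incr (t x y : R) : x <= y -> step t x <= step t y.
Proof. intros H. unfold step. destruct (Rle_dec t x), (Rle_dec t y); lra. Qed.

Lemma step_bounds (t x : R) : 0 <= step t x <= 1.
Proof. unfold step. destruct (Rle_dec t x); lra. Qed.

(** Only the cell containing the jump contributes, and its left endpoint is within one mesh width of
    [t]. *)
Lemma RS_sum_step_le (g : R -> R) (t a b osc : R) (N : nat) :
  a <= b -> 0 <= osc ->
  (forall u v, a <= u <= b -> a <= v <= b -> Rabs (u - v) <= (b - a) / INR (S N) ->
     g u - g v <= osc) ->
  RS_sum g (step t) a b N <= g t * (step t b - step t a) + osc.
Proof.
  intros Hab Ho Hg.
  apply Rle_trans with ((g t + osc) * step t b - (g t + osc) * step t a).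
  - apply (RS_sum_le_telescope g (step t) (fun x => (g t + osc) * step t x)).
    intros i Hi. rewrite <- Rmult_minus_distr_l.
    pose proof (grid_bounds a b N i Hab ltac:(lia)).
    pose proof (grid_bounds a b N (S i) Hab ltac:(lia)).
    pose proof (grid_step_nonneg a b N Hab).
    rewrite grid_S in *. unfold step.
    destruct (Rle_dec t (grid a b N i + (b - a) / INR (S N))), (Rle_dec t (grid a b N i)); try lra.
    assert (g (grid a b N i) - g t <= osc); [| lra].
    apply Hg; [lra | lra |]. rewrite Rabs_minus_sym, Rabs_right; lra.
  - pose proof (step_incr t a b Hab). pose proof (step_bounds t a). pose proof (step_bounds t b). nra.
Qed.

Lemma RS_sum_step_close (g : R -> R) (t a b osc : R) (N : nat) :
  a <= b -> 0 <= osc ->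
  (forall u v, a <= u <= b -> a <= v <= b -> Rabs (u - v) <= (b - a) / INR (S N) ->
     g u - g v <= osc) ->
  - osc <= RS_sum g (step t) a b N - g t * (step t b - step t a) <= osc.
Proof.
  intros Hab Ho Hg.
  pose proof (RS_sum_step_le g t a b osc N Hab Ho Hg).
  pose proof (RS_sum_step_le (fun x => - g x) t a b osc N Hab Ho) as H1.
  rewrite RS_sum_opp in H1.
  assert (H2 : forall u v, a <= u <= b -> a <= v <= b -> Rabs (u - v) <= (b - a) / INR (S N) ->
     - g u - - g v <= osc).
  { intros u v Hu Hv Huv. rewrite Rabs_minus_sym in Huv.
    specialize (Hg v u Hv Hu Huv). lra. }
  specialize (H1 H2). lra.
Qed.

Lemma pow_lipschitz (s : nat) (M : R) :
  exists K, 0 <= K /\ forall u v, - M <= u <= M -> - M <= v <= M ->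
    Rabs (u ^ s - v ^ s) <= K * Rabs (u - v).
Proof.
  induction s as [|s [K [HK IH]]].
  - exists 0. split; [lra |]. intros. simpl. rewrite Rminus_diag, Rabs_R0. lra.
  - exists (Rabs M * K + Rabs M ^ s). split.
    + pose proof (Rabs_pos M). pose proof (pow_le _ s H). nra.
    + intros u v Hu Hv. simpl.
      replace (u * u ^ s - v * v ^ s) with (u * (u ^ s - v ^ s) + v ^ s * (u - v)) by ring.
      eapply Rle_trans; [apply Rabs_triang |]. rewrite !Rabs_mult, <- RPow_abs.
      assert (Rabs u <= Rabs M) by (rewrite (Rabs_right M) by lra; apply Rabs_le; lra).
      assert (Rabs v <= Rabs M) by (rewrite (Rabs_right M) by lra; apply Rabs_le; lra).
      specialize (IH u v Hu Hv).
      pose proof (Rabs_pos u). pose proof (Rabs_pos v). pose proof (Rabs_pos (u ^ s - v ^ s)).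
      pose proof (Rabs_pos (u - v)).
      assert (Rabs v ^ s <= Rabs M ^ s) by (apply pow_incr; lra).
      rewrite Rmult_plus_distr_r. apply Rplus_le_compat.
      * rewrite Rmult_assoc. apply Rmult_le_compat; lra.
      * apply Rmult_le_compat_r; lra.
Qed.

Lemma momval_improper_RS (mu : nat -> R) (G : R -> R) :
  (forall s, has_moment G s (mu s)) ->
  forall f v, momval mu f v -> improper_RS f G v.
Proof.
  intros HG f v Hf. induction Hf as [s | c f g u v Hf [J1 [HJ1 HL1]] Hg [J2 [HJ2 HL2]]
                                     | f g u E Hf [J [HJ HL]]].
  - apply HG.
  - exists (fun M => c * J1 M + J2 M). split.
    + intros M HM. apply is_lim_seq_Reals.
      apply is_lim_seq_ext with (fun N => c * RS_sum f G (- M) M N + RS_sum g G (- M) M N).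
      { intros N. symmetry. apply RS_sum_lin. }
      apply is_lim_seq_plus'.
      * apply (is_lim_seq_scal_l _ c (Finite _)). now apply is_lim_seq_Reals, HJ1.
      * now apply is_lim_seq_Reals, HJ2.
    + intros eps He.
      assert (Hc : 0 < Rabs c + 1) by (pose proof (Rabs_pos c); lra).
      destruct (HL1 (eps / 2 / (Rabs c + 1))) as [M1 HM1];
        [apply Rdiv_lt_0_compat; lra |].
      destruct (HL2 (eps / 2)) as [M2 HM2]; [lra |].
      exists (Rmax M1 M2). intros M HM.
      pose proof (Rmax_l M1 M2). pose proof (Rmax_r M1 M2).
      specialize (HM1 M ltac:(lra)). specialize (HM2 M ltac:(lra)).
      replace (c * J1 M + J2 M - (c * u + v)) with (c * (J1 M - u) + (J2 M - v)) by ring.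
      eapply Rle_lt_trans; [apply Rabs_triang |]. rewrite Rabs_mult.
      assert (Rabs c * Rabs (J1 M - u) <= eps / 2); [| lra].
      apply Rle_trans with ((Rabs c + 1) * (eps / 2 / (Rabs c + 1))).
      * pose proof (Rabs_pos c). pose proof (Rabs_pos (J1 M - u)). apply Rmult_le_compat; lra.
      * right. field. lra.
  - exists J. split; [| exact HL]. intros M HM. apply is_lim_seq_Reals.
    apply is_lim_seq_ext with (fun N => RS_sum f G (- M) M N).
    { intros N. now apply RS_sum_ext. }
    now apply is_lim_seq_Reals, HJ.
Qed.

Lemma is_cdf_nonneg (G : R -> R) (x : R) : is_cdf G -> 0 <= G x.
Proof.
  intros (Hm & _ & H0 & _). apply Rnot_lt_le. intros Hx.
  destruct (H0 (- G x)) as [M HM]; [lra |].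
  pose proof (Rmin_l M x). pose proof (Rmin_r M x).
  specialize (HM (Rmin M x) H). specialize (Hm _ _ H1). apply Rabs_def2 in HM. lra.
Qed.

(** The increments of [Rmin (G x) (G c)] play the role of integrating the indicator of [x <= c]
    against [G]. They vanish on cells starting beyond [c], and every other cell has its tag at most
    [c], where [q >= 1]. *)
Lemma cdf_le_majorant (G q : R -> R) (c u : R) :
  is_cdf G -> improper_RS q G u ->
  (forall x, 0 <= q x) -> (forall x, x <= c -> 1 <= q x) -> G c <= u.
Proof.
  intros HG [J [HJ HL]] Hq0 Hq1. destruct HG as (Hm & _ & H0 & _).
  apply le_epsilon. intros eps He.
  destruct (HL (eps / 2)) as [M1 HM1]; [lra |].
  destruct (H0 (eps / 2)) as [M2 HM2]; [lra |].
  set (M := Rmax (Rmax M1 (- M2)) (Rabs c + 1)).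
  assert (HMa : M1 <= M /\ - M2 <= M /\ Rabs c + 1 <= M).
  { unfold M. pose proof (Rmax_l (Rmax M1 (- M2)) (Rabs c + 1)).
    pose proof (Rmax_r (Rmax M1 (- M2)) (Rabs c + 1)).
    pose proof (Rmax_l M1 (- M2)). pose proof (Rmax_r M1 (- M2)). lra. }
  destruct HMa as (K1 & K2 & K3). pose proof (Rabs_pos c).
  assert (Hc : - M <= c <= M).
  { pose proof (Rle_abs c). pose proof (Rle_abs (- c)) as H2. rewrite Rabs_Ropp in H2. lra. }
  specialize (HM1 M K1). specialize (HM2 (- M) ltac:(lra)).
  apply Rabs_def2 in HM1. apply Rabs_def2 in HM2.
  assert (HJM : G c - G (- M) <= J M).
  { apply is_lim_seq_ge_eventually with (fun N => RS_sum q G (- M) M N);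
      [apply is_lim_seq_Reals, HJ; lra |].
    exists 0%nat. intros N _.
    apply Rle_trans with (Rmin (G M) (G c) - Rmin (G (- M)) (G c)).
    { rewrite (Rmin_right (G M)), (Rmin_left (G (- M))); [lra | apply Hm; lra ..]. }
    apply (RS_sum_ge_telescope q G (fun x => Rmin (G x) (G c))).
    intros i _. set (x := grid (- M) M N i). set (y := grid (- M) M N (S i)).
    assert (Hxy : x <= y).
    { unfold x, y. rewrite grid_S. pose proof (grid_step_nonneg (- M) M N ltac:(lra)). lra. }
    pose proof (Hm x y Hxy). destruct (Rle_dec x c) as [Hx | Hx].
    - specialize (Hq1 x Hx). pose proof (Hm x c Hx).
      rewrite (Rmin_left (G x)) by easy. pose proof (Rmin_l (G y) (G c)). nra.
    - pose proof (Hm c x ltac:(lra)). rewrite !Rmin_right by lra.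
      specialize (Hq0 x). nra. }
  lra.
Qed.

(** A cell whose tag lies below [c] may end beyond [c]. The gap between [c] and [c'] contains this
    overshoot once the mesh is finer than [c' - c], so capping [G] at [G c'] loses nothing on such a
    cell. *)
Lemma minorant_le_cdf (G r : R -> R) (c c' v : R) :
  is_cdf G -> improper_RS r G v -> c < c' ->
  (forall x, r x <= 1) -> (forall x, c <= x -> r x <= 0) -> v <= G c'.
Proof.
  intros HG [J [HJ HL]] Hcc Hr1 Hr0.
  pose proof (fun x => is_cdf_nonneg G x HG) as Hpos. destruct HG as (Hm & _).
  apply le_epsilon. intros eps He.
  destruct (HL eps He) as [M1 HM1].
  set (M := Rmax M1 1).
  pose proof (Rmax_l M1 1) as K1. pose proof (Rmax_r M1 1) as K2. fold M in K1, K2.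
  specialize (HM1 M K1). apply Rabs_def2 in HM1.
  assert (HJM : J M <= G c').
  { apply is_lim_seq_le_eventually with (fun N => RS_sum r G (- M) M N);
      [apply is_lim_seq_Reals, HJ; lra |].
    destruct (is_lim_seq_lt_eventually (fun N => (M - - M) * / (0 + INR N)) ((M - - M) * 0) (c' - c))
      as [N0 HN0].
    { apply is_lim_seq_mult'; [apply is_lim_seq_const | apply is_lim_seq_inv_INR]. }
    { lra. }
    exists N0. intros N HN. specialize (HN0 (S N) ltac:(lia)). rewrite Rplus_0_l in HN0.
    apply Rle_trans with (Rmin (G M) (G c') - Rmin (G (- M)) (G c')).
    2:{ pose proof (Rmin_r (G M) (G c')).
        assert (0 <= Rmin (G (- M)) (G c')) by (apply Rmin_glb; apply Hpos). lra. }
    apply (RS_sum_le_telescope r G (fun x => Rmin (G x) (G c'))).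
    intros i _. set (x := grid (- M) M N i). set (y := grid (- M) M N (S i)).
    assert (Hy : y = x + (M - - M) * / INR (S N)) by apply grid_S.
    assert (Hxy : x <= y).
    { rewrite Hy. pose proof (grid_step_nonneg (- M) M N ltac:(lra)). unfold Rdiv in *. lra. }
    pose proof (Hm x y Hxy). destruct (Rle_dec c x) as [Hx | Hx].
    - specialize (Hr0 x Hx).
      assert (Rmin (G x) (G c') <= Rmin (G y) (G c')).
      { apply Rle_min_compat_r. easy. }
      nra.
    - rewrite !Rmin_left by (apply Hm; lra). specialize (Hr1 x). nra. }
  lra.
Qed.

(** * Convergence of the scaled laws and identification of the limit *)

Section LimitLaw.
Variables (k : nat) (hk : (1 <= k)%nat).
Let mu := Y0_moment k.

Lemma Y0_sandwich (a delta eps : R) :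
  0 < delta -> 0 < eps ->
  exists q r u v, momval mu q u /\ momval mu r v /\ u - v <= eps /\
    (forall x, 0 <= q x) /\ (forall x, x <= a - delta -> 1 <= q x) /\
    (forall x, r x <= 1) /\ (forall x, a + delta <= x -> r x <= 0).
Proof.
  apply polynomial_sandwich.
  - now apply Y0_moment_0.
  - intros s. now apply Y0_moment_nonneg.
  - intros T e HT He. now apply Y0_moment_growth.
Qed.

(** With the sandwich centred at [x + delta], the majorant handles [F x] and the minorant vanishes
    or is negative beyond [x + 2 delta]. The third [delta] is the strict gap of [minorant_le_cdf].
    Right-continuity of [G] then removes the shift. *)
Lemma cdf_le_of_moments (F G : R -> R) :
  is_cdf F -> is_cdf G ->
  (forall s, has_moment F s (mu s)) -> (forall s, has_moment G s (mu s)) ->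
  forall x, F x <= G x.
Proof.
  intros HF HG MF MG x.
  assert (H : forall delta eps, 0 < delta -> 0 < eps -> F x <= G (x + 3 * delta) + eps).
  { intros delta eps Hd He.
    destruct (Y0_sandwich (x + delta) delta eps Hd He)
      as (q & r & u & v & Hq & Hr & Huv & Hq0 & Hq1 & Hr1 & Hr0).
    assert (F x <= u).
    { apply cdf_le_majorant with q; try easy.
      - now apply (momval_improper_RS mu).
      - intros y Hy. apply Hq1. lra. }
    assert (v <= G (x + 3 * delta)).
    { apply minorant_le_cdf with r (x + delta + delta); try easy; [| lra].
      now apply (momval_improper_RS mu). }
    lra. }
  apply le_epsilon. intros eps He.
  destruct HG as (_ & Hrc & _). destruct (Hrc x (eps / 2)) as (d & Hd & Hcont); [lra |].
  specialize (H (d / 6) (eps / 2) ltac:(lra) ltac:(lra)).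
  specialize (Hcont (x + 3 * (d / 6)) ltac:(lra)). apply Rabs_def2 in Hcont. lra.
Qed.

Lemma scaled_cdf_Ex (n : nat) (x : R) :
  scaled_cdf k n x = Ex k n (fun y => step (INR y * scale k n) x).
Proof.
  unfold scaled_cdf. rewrite (prob_tree_Ex k n (fun y =>
    if Rle_dec (INR y * Rpower (INR n) (- (INR k / INR (k + 1)))) x then true else false)).
  apply Ex_ext. intros y. unfold indic, step, scale, kap. cbv beta.
  now destruct (Rle_dec _ x).
Qed.

Lemma momval_Ex_lim (f : R -> R) (v : R) :
  momval mu f v -> is_lim_seq (fun n => Ex k n (fun y => f (INR y * scale k n))) v.
Proof.
  intros Hf. induction Hf as [s | c f g u v Hf IHf Hg IHg | f g u E Hf IHf].
  - now apply Ex_moment_lim.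
  - apply is_lim_seq_ext with (fun n => c * Ex k n (fun y => f (INR y * scale k n)) +
      Ex k n (fun y => g (INR y * scale k n))).
    + intros n. now rewrite Ex_plus, Ex_scal.
    + apply is_lim_seq_plus'; [apply (is_lim_seq_scal_l _ c (Finite _)) |]; easy.
  - apply is_lim_seq_ext with (2 := IHf). intros n. apply Ex_ext. intros; apply E.
Qed.

Lemma scaled_cdf_incr (n : nat) (x y : R) : x <= y -> scaled_cdf k n x <= scaled_cdf k n y.
Proof.
  intros H. rewrite !scaled_cdf_Ex. apply Ex_le; [easy |]. intros. now apply step_incr.
Qed.

Lemma scaled_cdf_bounds (n : nat) (x : R) : 0 <= scaled_cdf k n x <= 1.
Proof.
  rewrite scaled_cdf_Ex. split.
  - apply Rle_trans with (Ex k n (fun _ => 0)); [rewrite Ex_const by easy; lra |].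
    apply Ex_le; [easy |]. intros; apply step_bounds.
  - apply Rle_trans with (Ex k n (fun _ => 1)); [| rewrite Ex_const by easy; lra].
    apply Ex_le; [easy |]. intros; apply step_bounds.
Qed.

(** At most [(y - x)/s + 2] integers [m] satisfy [x < m s <= y] for [s = scale k n], and each
    carries mass at most [K s]. *)
Lemma scaled_cdf_window :
  exists K, 0 < K /\ eventually (fun n => forall x y, x <= y ->
    scaled_cdf k n y - scaled_cdf k n x <= K * ((y - x) + 2 * scale k n)).
Proof.
  destruct (pmf_le_scale k hk) as (K & HK & N & HN). exists K. split; [easy |].
  exists N. intros n Hn x y Hxy. specialize (HN n Hn).
  pose proof (scale_pos k n) as Hs. set (s := scale k n) in *.
  rewrite !scaled_cdf_Ex, <- Ex_minus. fold s.
  (* The integers of the window lie between [M0] and [M0 + L]. For negative [x] the truncation of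
     [Z.to_nat] at 0 is harmless, out-degrees being nonnegative. *)
  set (M0 := Z.to_nat (up (x / s))). set (L := Z.to_nat (up ((y - x) / s))).
  assert (HM0 : x / s < INR M0).
  { apply Rlt_le_trans with (IZR (up (x / s))); [apply archimed |].
    unfold M0. rewrite INR_IZR_INZ. apply IZR_le. lia. }
  assert (Hyx : 0 <= (y - x) / s) by (apply Rdiv_le_0_compat; lra).
  destruct (archimed ((y - x) / s)) as [HL1 HL2].
  assert (HL : INR L = IZR (up ((y - x) / s))).
  { unfold L. rewrite INR_IZR_INZ. f_equal. rewrite Z2Nat.id; [easy |].
    apply le_IZR. lra. }
  apply Rle_trans with
    (Ex k n (fun m => sum_f_R0 (fun i => indic (fun m => Nat.eqb m (M0 + i)) m) L)).
  - apply Ex_le; [easy |]. intros m.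
    assert (H0 : forall i, 0 <= indic (fun m => Nat.eqb m (M0 + i)) m)
      by (intros; apply indic_bounds).
    pose proof (cond_pos_sum _ L H0) as HS.
    unfold step. destruct (Rle_dec (INR m * s) y) as [Hy |], (Rle_dec (INR m * s) x) as [| Hx];
      try lra.
    assert (Hm : x / s < INR m).
    { apply (Rmult_lt_reg_r s); [easy |]. unfold Rdiv. rewrite Rmult_assoc, Rinv_l; lra. }
    assert (HmM : (M0 <= m)%nat).
    { unfold M0. destruct (archimed (x / s)) as [_ Hup].
      assert (IZR (up (x / s)) < IZR (Z.of_nat m + 1)).
      { rewrite plus_IZR, <- INR_IZR_INZ. lra. }
      apply lt_IZR in H. lia. }
    assert (HmL : (m - M0 <= L)%nat).
    { assert (INR m <= y / s).
      { apply (Rmult_le_reg_r s); [easy |]. unfold Rdiv. rewrite Rmult_assoc, Rinv_l; lra. }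
      assert (H1 : INR m < INR (M0 + L)).
      { rewrite plus_INR, HL. replace (y / s) with (x / s + (y - x) / s) in H by (field; lra). lra. }
      apply INR_lt in H1. lia. }
    apply Rle_trans with (indic (fun m0 => Nat.eqb m0 (M0 + (m - M0))) m).
    + unfold indic. replace (M0 + (m - M0))%nat with m by lia. rewrite Nat.eqb_refl. lra.
    + now apply (sum_f_R0_ge_term (fun i => indic (fun m => Nat.eqb m (M0 + i)) m)).
  - rewrite Ex_sum. fold (pmf k n).
    apply Rle_trans with (sum_f_R0 (fun _ => K * s) L).
    + apply sum_Rle. intros i _. apply HN.
    + rewrite sum_cte, S_INR, HL.
      apply Rle_trans with (K * s * ((y - x) / s + 2)).
      * apply Rmult_le_compat_l; [left; now apply Rmult_lt_0_compat | lra].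
      * right. field. lra.
Qed.

(** The chain is [F_n x <= E_n q], close to [u], then [u <= v + eps/8], then [v] close to
    [E_m r <= F_m (x + 2d)], which the window bound brings back to [F_m x]. A one-sided estimate
    suffices, as [n] and [m] can be exchanged. *)
Lemma scaled_cdf_cauchy (x eps : R) :
  0 < eps -> exists N, forall n m, (N <= n)%nat -> (N <= m)%nat ->
    scaled_cdf k n x - scaled_cdf k m x < eps.
Proof.
  intros He. destruct scaled_cdf_window as (K & HK & N1 & HN1).
  (* Once [scale k m < d], the window of length [2 d] has mass at most [4 K d = eps/4]; the other
     errors are three times [eps/8]. *)
  set (d := eps / (16 * K)).
  assert (Hd : 0 < d) by (apply Rdiv_lt_0_compat; lra).
  destruct (Y0_sandwich (x + d) d (eps / 8) Hd ltac:(lra))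
    as (q & r & u & v & Hq & Hr & Huv & Hq0 & Hq1 & Hr1 & Hr0).
  destruct (is_lim_seq_lt_eventually _ u (u + eps / 8) (momval_Ex_lim q u Hq)) as [N2 HN2]; [lra |].
  destruct (is_lim_seq_gt_eventually _ v (v - eps / 8) (momval_Ex_lim r v Hr)) as [N3 HN3]; [lra |].
  destruct (is_lim_seq_lt_eventually _ 0 d (scale_lim k hk)) as [N4 HN4]; [easy |].
  exists (N1 + N2 + N3 + N4)%nat. intros n m Hn Hm.
  specialize (HN1 m ltac:(lia) x (x + d + d) ltac:(lra)).
  specialize (HN2 n ltac:(lia)). specialize (HN3 m ltac:(lia)). specialize (HN4 m ltac:(lia)).
  cbv beta in *.
  assert (A1 : scaled_cdf k n x <= Ex k n (fun y => q (INR y * scale k n))).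
  { rewrite scaled_cdf_Ex. apply Ex_le; [easy |]. intros y. unfold step.
    destruct (Rle_dec _ x); [apply Hq1; lra | apply Hq0]. }
  assert (A2 : Ex k m (fun y => r (INR y * scale k m)) <= scaled_cdf k m (x + d + d)).
  { rewrite scaled_cdf_Ex. apply Ex_le; [easy |]. intros y. unfold step.
    destruct (Rle_dec _ (x + d + d)); [apply Hr1 | apply Hr0; lra]. }
  assert (K * (x + d + d - x + 2 * scale k m) <= K * (4 * d)) by (apply Rmult_le_compat_l; lra).
  replace (K * (4 * d)) with (eps / 4) in H by (unfold d; field; lra).
  lra.
Qed.

Definition limit_cdf (x : R) : R := real (Lim_seq (fun n => scaled_cdf k n x)).

Lemma scaled_cdf_lim (x : R) : is_lim_seq (fun n => scaled_cdf k n x) (limit_cdf x).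
Proof.
  apply Lim_seq_correct'. apply ex_lim_seq_cauchy_corr.
  intros eps. destruct (scaled_cdf_cauchy x eps (cond_pos eps)) as [N HN].
  exists N. intros n m Hn Hm. apply Rabs_def1.
  - now apply HN.
  - specialize (HN m n Hm Hn). lra.
Qed.

Lemma limit_cdf_incr (x y : R) : x <= y -> limit_cdf x <= limit_cdf y.
Proof.
  intros H. assert (Hle : Rbar_le (limit_cdf x) (limit_cdf y)); [| exact Hle].
  eapply is_lim_seq_le; [| apply scaled_cdf_lim | apply scaled_cdf_lim].
  intros n. now apply scaled_cdf_incr.
Qed.

Lemma limit_cdf_lipschitz :
  exists K, 0 < K /\ forall x y, x <= y -> limit_cdf y - limit_cdf x <= K * (y - x).
Proof.
  destruct scaled_cdf_window as (K & HK & N & HN). exists K. split; [easy |].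
  intros x y Hxy.
  assert (Hle : Rbar_le (limit_cdf y - limit_cdf x) (K * ((y - x) + 2 * 0))).
  2:{ simpl in Hle. lra. }
  eapply is_lim_seq_le_loc with (u := fun n => scaled_cdf k n y - scaled_cdf k n x)
    (v := fun n => K * ((y - x) + 2 * scale k n)).
  - exists N. intros n Hn. now apply HN.
  - apply is_lim_seq_minus'; apply scaled_cdf_lim.
  - apply is_lim_seq_mult'; [apply is_lim_seq_const |].
    apply is_lim_seq_plus'; [apply is_lim_seq_const |].
    apply is_lim_seq_mult'; [apply is_lim_seq_const | now apply scale_lim].
Qed.

Lemma limit_cdf_neg (x : R) : x < 0 -> limit_cdf x = 0.
Proof.
  intros Hx.
  assert (E : is_lim_seq (fun n => scaled_cdf k n x) 0).
  { apply is_lim_seq_ext with (fun _ => 0); [| apply is_lim_seq_const].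
    intros n. rewrite scaled_cdf_Ex.
    transitivity (Ex k n (fun _ => 0)); [symmetry; now apply Ex_const |].
    apply Ex_ext. intros y. pose proof (pos_INR y). pose proof (scale_pos k n).
    assert (0 <= INR y * scale k n) by (apply Rmult_le_pos; lra).
    unfold step. destruct (Rle_dec (INR y * scale k n) x); lra. }
  apply is_lim_seq_unique in E. unfold limit_cdf. now rewrite E.
Qed.

(** The lower bound is Markov's inequality for the first moment, passed to the limit. *)
Lemma limit_cdf_tail (x : R) : 0 < x -> 1 - mu 1%nat / x <= limit_cdf x <= 1.
Proof.
  intros Hx. split.
  - assert (Hle : Rbar_le (1 - mu 1%nat / x) (limit_cdf x)); [| exact Hle].
    eapply is_lim_seq_le; [| | apply scaled_cdf_lim].
    2:{ apply is_lim_seq_minus' with (v := fun n => Ex k n (fun y => (INR y * scale k n) ^ 1) / x);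
          [apply is_lim_seq_const |].
        apply is_lim_seq_div'; [now apply Ex_moment_lim | apply is_lim_seq_const | lra]. }
    intros n. cbv beta. rewrite scaled_cdf_Ex.
    apply Rle_trans with (Ex k n (fun y => 1 - / x * (INR y * scale k n) ^ 1)).
    { rewrite Ex_minus, Ex_const, Ex_scal by easy. unfold Rdiv. right. ring. }
    apply Ex_le; [easy |]. intros y.
    pose proof (pos_INR y). pose proof (scale_pos k n).
    assert (0 <= INR y * scale k n) by (apply Rmult_le_pos; lra).
    assert (0 < / x) by now apply Rinv_0_lt_compat.
    rewrite pow_1. unfold step. destruct (Rle_dec (INR y * scale k n) x) as [|h]; [nra |].
    assert (1 <= / x * (INR y * scale k n)); [| lra].
    rewrite <- (Rinv_l x) by lra. apply Rmult_le_compat_l; lra.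
  - apply is_lim_seq_le_eventually with (1 := scaled_cdf_lim x).
    exists 0%nat. intros; apply scaled_cdf_bounds.
Qed.

Lemma limit_cdf_is_cdf : is_cdf limit_cdf.
Proof.
  split; [apply limit_cdf_incr |]. split; [| split].
  - intros x eps He. destruct limit_cdf_lipschitz as (K & HK & HL).
    exists (eps / K). split; [now apply Rdiv_lt_0_compat |].
    intros y Hy. pose proof (limit_cdf_incr x y (proj1 Hy)). specialize (HL x y (proj1 Hy)).
    rewrite Rabs_right by lra. eapply Rle_lt_trans; [exact HL |].
    apply Rlt_le_trans with (K * (eps / K)); [apply Rmult_lt_compat_l; lra | right; field; lra].
  - intros eps He. exists (-1). intros x Hx. rewrite limit_cdf_neg by lra. now rewrite Rabs_R0.
  - intros eps He. set (m1 := mu 1%nat).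
    assert (Hm1 : 0 <= m1) by now apply Y0_moment_nonneg.
    exists ((m1 + 1) / eps). intros x Hx.
    assert (Hx0 : 0 < (m1 + 1) / eps) by (apply Rdiv_lt_0_compat; lra).
    pose proof (limit_cdf_tail x ltac:(lra)) as HT. fold m1 in HT.
    assert (Hlt : m1 / x < eps).
    { apply (Rmult_lt_reg_r x); [lra |]. unfold Rdiv. rewrite Rmult_assoc, Rinv_l by lra.
      assert (eps * ((m1 + 1) / eps) <= eps * x) by (apply Rmult_le_compat_l; lra).
      replace (eps * ((m1 + 1) / eps)) with (m1 + 1) in H by (field; lra). lra. }
    apply Rabs_def1; lra.
Qed.

Lemma RS_sum_scaled_cdf (g : R -> R) (a b : R) (N n : nat) :
  RS_sum g (scaled_cdf k n) a b N =
  Ex k n (fun y => RS_sum g (step (INR y * scale k n)) a b N).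
Proof.
  unfold RS_sum. rewrite Ex_sum. apply sum_eq. intros i _.
  now rewrite Ex_scal, Ex_minus, <- !scaled_cdf_Ex.
Qed.

Lemma RS_sum_limit_cdf (g : R -> R) (a b : R) (N : nat) :
  is_lim_seq (fun n => RS_sum g (scaled_cdf k n) a b N) (RS_sum g limit_cdf a b N).
Proof.
  apply (is_lim_seq_sum_f_R0 (fun i n => g (grid a b N i) *
    (scaled_cdf k n (grid a b N (S i)) - scaled_cdf k n (grid a b N i)))).
  intros i. apply is_lim_seq_mult'; [apply is_lim_seq_const |].
  apply is_lim_seq_minus'; apply scaled_cdf_lim.
Qed.

(** An exchange of three limits: size, mesh and truncation [M]. The mesh error and the truncation
    error are bounded uniformly in [n], so letting [n] tend to infinity first is harmless. The
    function [g] stands for both [y^s] and [|y|^s]. *)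
Lemma improper_RS_limit_cdf (g : R -> R) (s : nat) :
  (forall x, 0 <= x -> g x = x ^ s) ->
  (forall M, exists K, 0 <= K /\ forall u v, - M <= u <= M -> - M <= v <= M ->
     g u - g v <= K * Rabs (u - v)) ->
  improper_RS g limit_cdf (mu s).
Proof.
  intros Hg Hlip.
  set (S_ := fun M N => RS_sum g limit_cdf (- M) M N).
  set (Jn := fun M n => Ex k n (fun y => g (INR y * scale k n) *
              (step (INR y * scale k n) M - step (INR y * scale k n) (- M)))).
  assert (Hosc : forall M, 0 < M -> exists K, 0 <= K /\ forall N n,
    - (K * / INR (S N)) <= RS_sum g (scaled_cdf k n) (- M) M N - Jn M n <= K * / INR (S N)).
  { intros M HM. destruct (Hlip M) as (K & HK & HL). exists (K * (M - - M)). split; [nra |].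
    intros N n. rewrite RS_sum_scaled_cdf. unfold Jn. rewrite <- Ex_minus.
    assert (H0 : 0 < / INR (S N)) by (apply Rinv_0_lt_compat, lt_0_INR; lia).
    assert (Hc : forall y, - (K * (M - - M) * / INR (S N)) <=
       RS_sum g (step (INR y * scale k n)) (- M) M N - g (INR y * scale k n) *
         (step (INR y * scale k n) M - step (INR y * scale k n) (- M)) <=
       K * (M - - M) * / INR (S N)).
    { intros y. apply RS_sum_step_close; [lra | |].
      - apply Rmult_le_pos; [nra | lra].
      - intros u v Hu Hv Huv. eapply Rle_trans; [now apply HL |].
        rewrite Rmult_assoc. apply Rmult_le_compat_l; [easy | exact Huv]. }
    split.
    - apply Rle_trans with (Ex k n (fun _ => - (K * (M - - M) * / INR (S N))));
        [rewrite Ex_const by easy; lra |].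
      apply Ex_le; [easy |]. intros y. apply Hc.
    - apply Rle_trans with (Ex k n (fun _ => K * (M - - M) * / INR (S N)));
        [| rewrite Ex_const by easy; lra].
      apply Ex_le; [easy |]. intros y. apply Hc. }
  (* Truncation loses only points [t > M], where [t^s <= t^(s+1) / M]; nothing lies at or below
     [- M], as [t >= 0]. *)
  assert (Htail : forall M n, 0 < M ->
    - (Ex k n (fun y => (INR y * scale k n) ^ S s) / M) <=
    Jn M n - Ex k n (fun y => (INR y * scale k n) ^ s) <= 0).
  { intros M n HM. unfold Jn. rewrite <- Ex_minus.
    assert (Hpt : forall y, - / M * (INR y * scale k n) ^ S s <=
      g (INR y * scale k n) * (step (INR y * scale k n) M - step (INR y * scale k n) (- M)) -
      (INR y * scale k n) ^ s <= 0).
    { intros y. pose proof (pos_INR y). pose proof (scale_pos k n).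
      assert (Ht : 0 <= INR y * scale k n) by (apply Rmult_le_pos; lra).
      set (t := INR y * scale k n) in *. rewrite (Hg t Ht).
      pose proof (pow_le t s Ht). assert (0 < / M) by now apply Rinv_0_lt_compat.
      assert (0 <= / M * t ^ S s) by (apply Rmult_le_pos; [lra | now apply pow_le]).
      unfold step. destruct (Rle_dec t (- M)); [lra |]. destruct (Rle_dec t M); [lra |].
      assert (t ^ s <= / M * t ^ S s); [| lra].
      simpl. rewrite <- (Rmult_1_l (t ^ s)) at 1. rewrite <- Rmult_assoc.
      apply Rmult_le_compat_r; [easy |].
      rewrite <- (Rinv_l M) by lra. apply Rmult_le_compat_l; lra. }
    split.
    - apply Rle_trans with (Ex k n (fun y => - / M * (INR y * scale k n) ^ S s)).
      + rewrite Ex_scal. unfold Rdiv. right. ring.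
      + apply Ex_le; [easy |]. intros y. apply Hpt.
    - apply Rle_trans with (Ex k n (fun _ => 0)); [| rewrite Ex_const by easy; lra].
      apply Ex_le; [easy |]. intros y. apply Hpt. }
  (* For two meshes the sums at size [n] share the same target [Jn M n]. Their distance is thus
     small uniformly in [n], and the bound passes to [limit_cdf], giving a Cauchy sequence. *)
  assert (HJ : forall M, 0 < M -> is_lim_seq (S_ M) (real (Lim_seq (S_ M)))).
  { intros M HM. apply Lim_seq_correct'. apply ex_lim_seq_cauchy_corr.
    destruct (Hosc M HM) as (K & HK & HO).
    intros eps. pose proof (cond_pos eps) as He.
    destruct (is_lim_seq_lt_eventually (fun N => K * / (0 + INR N)) (K * 0) (eps / 3)) as [N0 HN0].
    { apply is_lim_seq_mult'; [apply is_lim_seq_const | apply is_lim_seq_inv_INR]. }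
    { lra. }
    exists N0. intros N N' HN HN'.
    assert (Hd : forall N N', (N0 <= N)%nat -> (N0 <= N')%nat ->
       S_ M N - S_ M N' <= 2 * (eps / 3)).
    { clear N N' HN HN'. intros N N' HN HN'.
      pose proof (HN0 (S N) ltac:(lia)) as B1. pose proof (HN0 (S N') ltac:(lia)) as B2.
      rewrite Rplus_0_l in B1, B2.
      apply is_lim_seq_le_eventually with (fun n =>
        RS_sum g (scaled_cdf k n) (- M) M N - RS_sum g (scaled_cdf k n) (- M) M N').
      - apply is_lim_seq_minus'; apply RS_sum_limit_cdf.
      - exists 0%nat. intros n _. pose proof (HO N n). pose proof (HO N' n). lra. }
    pose proof (Hd N N' HN HN'). pose proof (Hd N' N HN' HN). apply Rabs_def1; lra. }
  exists (fun M => real (Lim_seq (S_ M))). split.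
  - intros M HM. apply is_lim_seq_Reals. now apply HJ.
  - intros eps He. set (B := mu (S s)).
    assert (HB : 0 <= B) by now apply Y0_moment_nonneg.
    exists ((B + 1) / eps). intros M HM.
    assert (Hx0 : 0 < (B + 1) / eps) by (apply Rdiv_lt_0_compat; lra).
    assert (HM0 : 0 < M) by lra.
    assert (Hlt : B / M < eps).
    { apply (Rmult_lt_reg_r M); [lra |]. unfold Rdiv. rewrite Rmult_assoc, Rinv_l by lra.
      assert (eps * ((B + 1) / eps) <= eps * M) by (apply Rmult_le_compat_l; lra).
      replace (eps * ((B + 1) / eps)) with (B + 1) in H by (field; lra). lra. }
    destruct (Hosc M HM0) as (K & HK & HO).
    assert (HS : forall N, - (K * / INR (S N)) - B / M <= S_ M N - mu s <= K * / INR (S N)).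
    { intros N.
      assert (HL : is_lim_seq (fun n => RS_sum g (scaled_cdf k n) (- M) M N -
         Ex k n (fun y => (INR y * scale k n) ^ s)) (S_ M N - mu s)).
      { apply is_lim_seq_minus'; [apply RS_sum_limit_cdf | now apply Ex_moment_lim]. }
      split.
      - assert (Hle : Rbar_le (- (K * / INR (S N)) - B / M) (S_ M N - mu s)); [| exact Hle].
        eapply is_lim_seq_le; [| | exact HL].
        2:{ apply is_lim_seq_minus' with (v := fun n =>
              Ex k n (fun y => (INR y * scale k n) ^ S s) / M); [apply is_lim_seq_const |].
            apply is_lim_seq_div'; [now apply Ex_moment_lim | apply is_lim_seq_const | lra]. }
        intros n. pose proof (HO N n). pose proof (Htail M n HM0). cbv beta. lra.
      - apply is_lim_seq_le_eventually with (1 := HL). exists 0%nat. intros n _.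
        pose proof (HO N n). pose proof (Htail M n HM0). cbv beta. lra. }
    assert (HK0 : is_lim_seq (fun N => K * / INR (S N)) 0).
    { replace (Finite 0) with (Finite (K * 0)) by (f_equal; ring).
      apply is_lim_seq_mult'; [apply is_lim_seq_const |].
      apply (is_lim_seq_incr_1 (fun N => / INR N)).
      apply is_lim_seq_ext with (fun N => / (0 + INR N));
        [intros; now rewrite Rplus_0_l | apply is_lim_seq_inv_INR]. }
    assert (HLJ : is_lim_seq (fun N => S_ M N - mu s) (real (Lim_seq (S_ M)) - mu s)).
    { apply is_lim_seq_minus'; [now apply HJ | apply is_lim_seq_const]. }
    assert (Hup : Rbar_le (real (Lim_seq (S_ M)) - mu s) 0).
    { eapply is_lim_seq_le; [| exact HLJ | exact HK0]. intros N. apply HS. }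
    assert (Hlo : Rbar_le (- 0 - B / M) (real (Lim_seq (S_ M)) - mu s)).
    { apply is_lim_seq_le with (u := fun N => - (K * / INR (S N)) - B / M)
        (v := fun N => S_ M N - mu s); [intros N; apply HS | | exact HLJ].
      apply is_lim_seq_minus'; [| apply is_lim_seq_const].
      apply (is_lim_seq_opp (fun N => K * / INR (S N)) (Finite 0)), HK0. }
    simpl in Hup, Hlo. apply Rabs_def1; lra.
Qed.

Lemma limit_cdf_has_moment (s : nat) : has_moment limit_cdf s (mu s).
Proof.
  split; [exists (mu s) |]; apply improper_RS_limit_cdf.
  - intros x Hx. now rewrite Rabs_right by lra.
  - intros M. destruct (pow_lipschitz s M) as (K & HK & HL). exists K. split; [easy |].
    intros u v Hu Hv.
    assert (Hu' : - M <= Rabs u <= M) by (pose proof (Rabs_pos u); split; [lra | apply Rabs_le; lra]).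
    assert (Hv' : - M <= Rabs v <= M) by (pose proof (Rabs_pos v); split; [lra | apply Rabs_le; lra]).
    specialize (HL _ _ Hu' Hv'). pose proof (Rle_abs (Rabs u ^ s - Rabs v ^ s)).
    assert (K * Rabs (Rabs u - Rabs v) <= K * Rabs (u - v)); [| lra].
    apply Rmult_le_compat_l; [easy | apply Rabs_triang_inv2].
  - easy.
  - intros M. destruct (pow_lipschitz s M) as (K & HK & HL). exists K. split; [easy |].
    intros u v Hu Hv. specialize (HL _ _ Hu Hv). pose proof (Rle_abs (u ^ s - v ^ s)). lra.
Qed.

End LimitLaw.

Theorem theorem2 (k : nat) (hk : (1 <= k)%nat) :
  (forall n m : nat,
     P_Y k n m =
     binomR (INR m - (INR k - 1) / INR k) m / binomR (INR n - INR k / INR (k + 1)) n *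
     sum_f_R0 (fun l => Binomial.C m l * (-1) ^ l *
                        binomR (INR n - 1 - INR k * INR l / INR (k + 1)) n) m) /\
  (exists F : R -> R,
     is_cdf F /\
     (forall s : nat, has_moment F s (Y0_moment k s)) /\
     (forall G : R -> R, is_cdf G -> (forall s : nat, has_moment G s (Y0_moment k s)) ->
        forall x, G x = F x) /\
     (forall x, continuity_pt F x -> Un_cv (fun n => scaled_cdf k n x) (F x))).
Proof.
  split; [intros n m; now apply P_Y_formula |].
  pose proof (limit_cdf_is_cdf k hk) as HF. pose proof (limit_cdf_has_moment k hk) as HM.
  exists (limit_cdf k). split; [exact HF |]. split; [exact HM |]. split.
  - intros G HG HMG x. apply Rle_antisym; now apply (cdf_le_of_moments k hk).
  - intros x _. apply is_lim_seq_Reals. now apply scaled_cdf_lim.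
Qed.
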